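(* Let $k\ge2$ be an integer, let $K$ be a number field of degree $d$ over $\mathbb{Q}$ with ring of integers $\mathcal{O}_K$, and let $\operatorname{Var}^{(k)}_{\mathcal{O}_K}(N)$ be the variance of $k$-free integers of $\mathcal{O}_K$ in balls of radius $N$, $$\operatorname{Var}^{(k)}_{\mathcal{O}_K}(N)=\lim_{M\to\infty}\frac{1}{\#B_M}\sum_{m\in B_M}\left(\sum_{n:\ n-m\in B_N}\mu^{(k)}(n)-\rho^{(k)}_{\mathcal{O}_K}\,\#B_N\right)^2 .$$ Then, as $N\to\infty$, $$\operatorname{Var}^{(k)}_{\mathcal{O}_K}(N)=O_{K,k}\left(N^{2d-1}\right).$$
   Context: For an ideal $\mathfrak{a}$ of $\mathcal{O}_K$, put $\mu^{(k)}(\mathfrak{a})=1$ if $\mathfrak{a}\not\subseteq\mathfrak{p}^k$ for every (nonzero) prime ideal $\mathfrak{p}$, and $\mu^{(k)}(\mathfrak{a})=0$ otherwise; $\mathfrak{a}$ is called $k$-free if $\mu^{(k)}(\mathfrak{a})=1$. An element $a\in\mathcal{O}_K$ is called $k$-free if the principal ideal $(a)$ is $k$-free, and $\mu^{(k)}(a):=\mu^{(k)}((a))$. Put $\rho^{(k)}_{\mathcal{O}_K}=1/\zeta_K(k)$, where $\zeta_K$ is the Dedekind zeta function of $K$; this is the density of the $k$-free elements of $\mathcal{O}_K$. Fix any group isomorphism $\iota:(\mathbb{Z}^d,+)\to(\mathcal{O}_K,+)$, let $\|\cdot\|$ on $\mathcal{O}_K$ be the image under $\iota$ of the $L^1$-norm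 on $\mathbb{Z}^d$, and let $B_x=\{a\in\mathcal{O}_K:\|a\|\le x\}$ be the $\|\cdot\|$-ball of radius $x$ centered at the origin. In the definition of the variance, $n$ runs over elements of $\mathcal{O}_K$; the limit exists. The notation $O_{K,k}$ means that the implied constant depends only on $K$ and $k$ (with the identification $\iota$ fixed). *)

(* Defs.v *)
From HB Require Import structures.
From mathcomp Require Import all_boot all_order all_algebra all_field.
From mathcomp Require Import finmap.
From mathcomp Require Import all_classical all_reals all_analysis.

Set Implicit Arguments.
Unset Strict Implicit.
Unset Printing Implicit Defensive.
Import Order.TTheory GRing.Theory Num.Theory.
Import numFieldNormedType.Exports.
Local Open Scope classical_set_scope.
Local Open Scope ring_scope.

(* A number field is a K : fieldExtType rat, of degree \dim {:K} over Q. *)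

Section RingOfIntegers.
Variable K : fieldExtType rat.

Definition integral_elt : {pred K} :=
  fun x => `[< integralOver (intr : int -> K) x >].

Lemma integral_elt_subring : subring_closed integral_elt.
Proof.
split; first exact/asboolP/integral1.
- by move=> x y /asboolP hx /asboolP hy; apply/asboolP/integral_sub.
- by move=> x y /asboolP hx /asboolP hy; apply/asboolP/integral_mul.
Qed.
HB.instance Definition _ :=
  GRing.isSubringClosed.Build K integral_elt integral_elt_subring.

Record ringOfIntegers := RingOfIntegers {
  int_val :> K;
  int_valP : int_val \in integral_elt
}.
HB.instance Definition _ := [isSub for int_val].
HB.instance Definition _ := [Choice of ringOfIntegers by <:].
HB.instance Definition _ :=
  [SubChoice_isSubComNzRing of ringOfIntegers by <:].

End RingOfIntegers.

Section Ideals.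
Variable A : comNzRingType.
Implicit Types I J P : set A.

Definition is_ideal I :=
  [/\ I 0, forall x y, I x -> I y -> I (x + y) & forall a x, I x -> I (a * x)].

(* idealr_closed already requires 1 \notin P. *)
Definition is_prime_ideal P :=
  idealr_closed [in P] /\ prime_idealr_closed [in P].

Definition principal_ideal (a : A) : set A := [set b * a | b in [set: A]].

Definition ideal_mul I J : set A :=
  [set x | exists n (u v : 'I_n -> A),
     [/\ forall i, I (u i), forall i, J (v i) & x = \sum_i u i * v i]].

Definition ideal_pow I k : set A := iter k (ideal_mul I) [set: A].

Definition ideal_coset I (x : A) : set A := [set y | I (y - x)].

(* The cardinality of A / I; the value is 0 when A / I is infinite, which in a
   ring of integers happens only for I = 0. *)
Definition ideal_norm I : nat := #|` fset_set (range (ideal_coset I))|.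

End Ideals.

Section KFree.
Variables (R : realType) (K : fieldExtType rat).
Local Notation OK := (ringOfIntegers K).

(* Dirichlet series over the nonzero ideals, as an element of [0, +oo]. *)
Definition dedekind_zeta (s : R) : \bar R :=
  \esum_(I in [set I : set OK | is_ideal I /\ I <> [set 0]])
     ((ideal_norm I)%:R `^ (- s))%:E.

Definition kfree_ideal (k : nat) (I : set OK) : Prop :=
  forall P : set OK,
    is_prime_ideal P -> P <> [set 0] -> ~ (I `<=` ideal_pow P k).

Definition kfree_mu_ideal (k : nat) (I : set OK) : R :=
  (`[< kfree_ideal k I >])%:R.

Definition kfree_mu (k : nat) (a : OK) : R :=
  kfree_mu_ideal k (principal_ideal a).

Definition kfree_density (k : nat) : R := (fine (dedekind_zeta k%:R))^-1.

End KFree.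

Section Variance.
Variables (R : realType) (K : fieldExtType rat) (d : nat).
Local Notation OK := (ringOfIntegers K).
Variable iota : 'rV[int]_d -> OK.

(* The norm transported from Z^d; meant for bijective iota. *)
Definition int_norm (a : OK) : R :=
  \sum_(i < d) `|('pinv_(fun=> 0) [set: 'rV[int]_d] iota a) 0 i|%:~R.

Definition int_ball (x : R) : set OK := [set a | int_norm a <= x].

Definition ball_card (x : R) : R := #|` fset_set (int_ball x)|%:R.

(* The \sum_(_ \in _) below range over finite sets. *)
Definition mean_square (k : nat) (N M : R) : R :=
  (ball_card M)^-1 * \sum_(m \in int_ball M)
     (\sum_(n \in [set n | int_ball N (n - m)]) kfree_mu R k n
        - kfree_density R K k * ball_card N) ^+ 2.

Definition kfree_variance (k : nat) (N : R) : R :=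
  lim (mean_square k N M @[M --> +oo]).

End Variance.

(* Main.v *)
Require Import Defs.
From HB Require Import structures.
From mathcomp Require Import all_boot all_order all_algebra all_field.
From mathcomp Require Import finmap.
From mathcomp Require Import all_classical all_reals all_analysis.
From mathcomp Require Import ring lra zify.
Import Order.TTheory GRing.Theory Num.Theory.
Import numFieldNormedType.Exports.
Local Open Scope classical_set_scope.
Local Open Scope ring_scope.
Set Implicit Arguments.
Unset Strict Implicit.
Unset Printing Implicit Defensive.

(** Let A be the ring of integers, identified with Z^d by iota, and let B be the
    ball of radius N, with #B = O(N^d) points. Every nonzero ideal I of A has
    finite index N(I).

    Geometry. The points of B are equidistributed among the cosets of any
    nonzero ideal I, with an error at most D = d (2N+1)^(d-1) that does not
    depend on I ([hits_equidistributed]): on a line parallel to a coordinate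
    axis, a coset of I is empty or an arithmetic progression whose step depends
    only on I and the axis, so shifting the coset along this axis changes the
    count in B by at most one per line that meets B.

    Sieve. Replace the k-free indicator by the indicator of the elements outside
    P^k for finitely many primes P. It is periodic, and by the Chinese remainder
    theorem the conditions at different P are independent ([mean_mod_prod]). The
    second moment of the count in a translate of B is therefore the sum over
    b, c in B of the product over P of 1 - 2/q + [b = c mod P^k]/q, where
    q = N(P^k). Expanding this product gives nonnegative weights times
    congruence conditions modulo ideals; inserting the equidistribution, the main
    terms add up to the square of the mean, and the errors to at most #B D, since
    the weights sum to at most 1 ([pair_sum_bound], [sieve_variance_le]). So all
    these finite sieves have variance at most #B D = O(N^(2d-1)), whatever the
    set of primes.

    Passage to the limit. A nonzero vector of length l in I forces
    N(I) = O(l^d), so I has at most C n^d / N(I) nonzero points in the ball of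
    radius n ([ideal_ball_sparse]). As the sum of N(P)^(-k) converges (at most d
    primes have a given least positive integer m, and their norms are at least
    m), the elements divisible by P^k for some large P are rare uniformly in n
    ([sieve_excess_sum]). Hence the mean squares of the k-free errors are
    uniformly approximated by those of the finite sieves, which converge to
    their variances ([mean_square_approx]); they converge too, and the limit
    inherits the bound.

    Density. It remains that the product of 1 - N(P)^(-k) over all primes is
    1/zeta_K(k) ([ef_cvg]). This is the Euler product, which rests on the unique
    factorisation of ideals and on the multiplicativity of the norm; both follow
    from the invertibility of nonzero primes, that is, from A being integrally
    closed with finite residue rings. *)

(** * The semiring of ideals *)

(* Lets an ideal, through its underlying set, be applied to an element. *)
Identity Coercion set_membership : set >-> Funclass.

Section IdealSemiring.
Variable A : comNzRingType.

(** Ideals under sum and product form a commutative semiring; with this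
    structure, products of primes are iterated products and powers. *)
Record ideal := Ideal { ideal_set :> set A; idealP : is_ideal ideal_set }.

HB.instance Definition _ := gen_eqMixin ideal.
HB.instance Definition _ := gen_choiceMixin ideal.

Implicit Types I J L : ideal.

Lemma ideal_eq I J : (forall x, I x <-> J x) -> I = J.
Proof.
case: I J => [I hI] [J hJ] /= IJ.
have eIJ : I = J by apply/funext => x; apply/propext.
by subst J; congr Ideal; apply: Prop_irrelevance.
Qed.

Lemma ideal0 I : I 0. Proof. by case: (idealP I). Qed.
Lemma idealD I x y : I x -> I y -> I (x + y).
Proof. by case: (idealP I) => _ h _; apply: h. Qed.
Lemma idealMl I a x : I x -> I (a * x).
Proof. by case: (idealP I) => _ _ h; apply: h. Qed.
Lemma idealMr I a x : I x -> I (x * a).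
Proof. by rewrite mulrC; apply: idealMl. Qed.
Lemma idealN I x : I x -> I (- x).
Proof. by rewrite -mulN1r; apply: idealMl. Qed.
Lemma idealB I x y : I x -> I y -> I (x - y).
Proof. by move=> Ix /idealN; apply: idealD. Qed.
Lemma idealBC I x y : I (x - y) -> I (y - x).
Proof. by move=> /idealN; rewrite opprB. Qed.
Lemma idealBtrans I x y z : I (x - y) -> I (y - z) -> I (x - z).
Proof. by move=> h1 h2; rewrite -(subrKA y); apply: idealD. Qed.
Lemma ideal_sum I (T : Type) (r : seq T) (F : T -> A) :
  (forall i, I (F i)) -> I (\sum_(i <- r) F i).
Proof.
by move=> IF; apply: (big_ind I); [apply: ideal0 | apply: idealD | move=> i _].
Qed.

Lemma zero_is_ideal : is_ideal [set (0 : A)].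
Proof.
by split=> [|x y /= -> ->|a x /= ->]; rewrite ?addr0 ?mulr0.
Qed.
Definition zero_ideal := Ideal zero_is_ideal.

Lemma unit_is_ideal : is_ideal [set: A]. Proof. by []. Qed.
Definition unit_ideal := Ideal unit_is_ideal.

Lemma add_is_ideal I J : is_ideal [set x | exists2 i, I i & J (x - i)].
Proof.
split=> [|x y [i Ii Ji] [j Ij Jj]|a x [i Ii Ji]] /=.
- by exists 0; rewrite ?subr0; apply: ideal0.
- by exists (i + j); [apply: idealD | rewrite opprD addrACA; apply: idealD].
- by exists (a * i); [apply: idealMl | rewrite -mulrBr; apply: idealMl].
Qed.
Definition ideal_add I J := Ideal (add_is_ideal I J).

Lemma mul_is_ideal I J : is_ideal (ideal_mul I J).
Proof.
split=> [|x y [m [u [v [Iu Jv ->]]]] [n [u' [v' [Iu' Jv' ->]]]]|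
         a x [m [u [v [Iu Jv ->]]]]].
- exists 0, (fun _ => 0), (fun _ => 0); split; try by move=> i; apply: ideal0.
  by rewrite big_ord0.
- exists (m + n)%N, (fun i => match fintype.split i with inl j => u j | inr j => u' j end),
    (fun i => match fintype.split i with inl j => v j | inr j => v' j end).
  split; try by move=> i; case: fintype.split.
  rewrite big_split_ord; congr (_ + _); apply: eq_bigr => i _.
    by rewrite -[lshift _ _]/(unsplit (inl i)) unsplitK.
  by rewrite -[rshift _ _]/(unsplit (inr i)) unsplitK.
- exists m, (fun i => a * u i), v; split=> // [i|]; first exact: idealMl.
  by rewrite mulr_sumr; apply: eq_bigr => i _; rewrite mulrA.
Qed.
Definition ideal_prod I J := Ideal (mul_is_ideal I J).

Lemma ideal_prodM I J x y : I x -> J y -> ideal_prod I J (x * y).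
Proof.
by move=> Ix Jy; exists 1, (fun=> x), (fun=> y); rewrite big_ord1.
Qed.

(** The universal property of the product, which replaces computation with
    sums of products. *)
Lemma ideal_prod_ind I J L :
  (forall x y, I x -> J y -> L (x * y)) -> ideal_prod I J `<=` L.
Proof.
by move=> h x [n [u [v [Iu Jv ->]]]]; apply: ideal_sum => i; apply: h.
Qed.

Lemma colon_is_ideal I (a : A) : is_ideal [set x | I (a * x)].
Proof.
split=> [|x y /= h1 h2|b x /= h]; first by rewrite /= mulr0; apply: ideal0.
  by rewrite mulrDr; apply: idealD.
by rewrite mulrCA; apply: idealMl.
Qed.
Definition colon I a := Ideal (colon_is_ideal I a).

Lemma ideal_prodC : commutative ideal_prod.
Proof.
have sub I J : ideal_prod I J `<=` ideal_prod J I.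
  by apply: ideal_prod_ind => x y Ix Jy; rewrite mulrC; apply: ideal_prodM.
by move=> I J; apply: ideal_eq => x; split; apply: sub.
Qed.

Lemma ideal_prodA : associative ideal_prod.
Proof.
have sub I J L : ideal_prod I (ideal_prod J L) `<=` ideal_prod (ideal_prod I J) L.
  apply: ideal_prod_ind => x y Ix JLy.
  apply: (ideal_prod_ind (L := colon (ideal_prod (ideal_prod I J) L) x)) JLy.
  move=> j l Jj Ll; rewrite -[colon _ _ _]/(ideal_prod _ L (x * (j * l))) mulrA.
  by do 2![apply: ideal_prodM => //].
move=> I J L; apply: ideal_eq => x; split; first exact: sub.
by rewrite (ideal_prodC _ L) (ideal_prodC I (ideal_prod J L)) (ideal_prodC J)
     (ideal_prodC I); apply: sub.
Qed.

Lemma ideal_mul1 : left_id unit_ideal ideal_prod.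
Proof.
move=> I; apply: ideal_eq => x; split=> [|Ix].
  by apply: ideal_prod_ind => a y _; apply: idealMl.
by rewrite -[x]mul1r; apply: ideal_prodM.
Qed.

Lemma ideal_addA : associative ideal_add.
Proof.
move=> I J L; apply: ideal_eq => x; split=> [[i Ii [j Jj Lx]]|[y [i Ii Jj] Lx]].
  exists (i + j); last by rewrite opprD addrA.
  by exists i => //; rewrite addrC addKr.
by exists i => //; exists (y - i) => //; rewrite opprB addrA subrK.
Qed.

Lemma ideal_addC : commutative ideal_add.
Proof.
have sub I J : ideal_add I J `<=` ideal_add J I.
  by move=> x [i Ii Ji]; exists (x - i) => //; rewrite subKr.
by move=> I J; apply: ideal_eq => x; split; apply: sub.
Qed.

Lemma ideal_add0 : left_id zero_ideal ideal_add.
Proof.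
move=> I; apply: ideal_eq => x; split=> [[i /= ->]|Ix]; first by rewrite subr0.
by exists 0; rewrite ?subr0.
Qed.

Lemma ideal_prod0 : left_zero zero_ideal ideal_prod.
Proof.
move=> I; apply: ideal_eq => x; split=> [|x0]; last by rewrite [x]x0; exact: ideal0.
by apply: ideal_prod_ind => _ y /= -> _; rewrite mul0r.
Qed.

Lemma ideal_prodDl : left_distributive ideal_prod ideal_add.
Proof.
move=> I J L; apply: ideal_eq => x; split.
  apply: ideal_prod_ind => y z [i Ii Ji] Lz.
  exists (i * z); first exact: ideal_prodM.
  by rewrite -mulrBl; apply: ideal_prodM.
case=> i ILi JLi; rewrite -(subrK i x); apply: idealD.
  apply: ideal_prod_ind JLi => j l Jj Ll; apply: ideal_prodM => //.
  by exists 0; rewrite ?subr0 //; apply: ideal0.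
apply: ideal_prod_ind ILi => j l Jj Ll; apply: ideal_prodM => //.
by exists j; rewrite ?subrr //; apply: ideal0.
Qed.

HB.instance Definition _ :=
  GRing.isNmodule.Build ideal ideal_addA ideal_addC ideal_add0.
HB.instance Definition _ :=
  GRing.Nmodule_isComPzSemiRing.Build ideal
    ideal_prodA ideal_prodC ideal_mul1 ideal_prodDl ideal_prod0.

Lemma ideal1E x : (1 : ideal) x. Proof. by []. Qed.

Lemma ideal0E x : (0 : ideal) x -> x = 0. Proof. by []. Qed.

Lemma ideal_mulM I J x y : I x -> J y -> (I * J)%R (x * y).
Proof. exact: ideal_prodM. Qed.

Lemma ideal_mul_ind I J L :
  (forall x y, I x -> J y -> L (x * y)) -> I * J `<=` L.
Proof. exact: ideal_prod_ind. Qed.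

Lemma ideal_mulSl I J : I * J `<=` I.
Proof. by apply: ideal_mul_ind => x y Ix _; apply: idealMr. Qed.
Lemma ideal_mulSr I J : I * J `<=` J.
Proof. by rewrite mulrC; apply: ideal_mulSl. Qed.
Lemma ideal_mulS I I' J J' : I `<=` I' -> J `<=` J' -> I * J `<=` I' * J'.
Proof.
by move=> sI sJ; apply: ideal_mul_ind => x y /sI Ix /sJ; apply: ideal_mulM.
Qed.

Lemma ideal_addSl I J : I `<=` I + J.
Proof. by move=> x Ix; exists x; rewrite ?subrr //; apply: ideal0. Qed.
Lemma ideal_addSr I J : J `<=` I + J.
Proof. by rewrite addrC; apply: ideal_addSl. Qed.

Lemma ideal_eq1 I : I 1 -> I = 1.
Proof.
by move=> I1; apply: ideal_eq => x; split=> // _; rewrite -[x]mulr1; apply: idealMl.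
Qed.

Lemma ideal_neq0 I : I <> 0 -> exists2 x, I x & x <> 0.
Proof.
move=> I0; apply: contrapT => h; apply: I0; apply: ideal_eq => x; split.
  by move=> Ix; apply: contrapT => x0; apply: h; exists x.
by move=> /= ->; apply: ideal0.
Qed.

Lemma ideal_neq0W I J : I <> 0 -> I `<=` J -> J <> 0.
Proof. by move=> /ideal_neq0[x Ix x0] IJ J0; move: (IJ _ Ix); rewrite J0. Qed.

Lemma ideal_powE I k : ideal_pow I k = I ^+ k :> set A.
Proof.
by elim: k => [|k IHk] //; rewrite exprS /ideal_pow iterS -/(ideal_pow I k) IHk.
Qed.

Lemma principal_is_ideal (a : A) : is_ideal (principal_ideal a).
Proof.
split=> [|x y [b _ <-] [c _ <-]|c x [b _ <-]].
- by exists 0; rewrite ?mul0r.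
- by exists (b + c); rewrite ?mulrDl.
- by exists (c * b); rewrite ?mulrA.
Qed.
Definition pideal a := Ideal (principal_is_ideal a).

Lemma pidealP a x : pideal a x <-> exists b, x = b * a.
Proof. by split=> [[b _ <-]|[b ->]]; exists b. Qed.

Lemma pideal_id a : pideal a a. Proof. by apply/pidealP; exists 1; rewrite mul1r. Qed.

Lemma pidealS I a : pideal a `<=` I <-> I a.
Proof.
by split=> [|Ia x /pidealP[b ->]]; [apply; apply: pideal_id | apply: idealMl].
Qed.

Lemma pidealMP a I x : (pideal a * I)%R x <-> exists2 y, I y & x = a * y.
Proof.
split=> [|[y Iy ->]]; last by apply: ideal_mulM => //; apply: pideal_id.
have h : is_ideal [set x | exists2 y, I y & x = a * y].
  split=> [|u v [y Iy ->] [z Iz ->]|c u [y Iy ->]].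
  - by exists 0; rewrite ?mulr0 //; apply: ideal0.
  - by exists (y + z); rewrite ?mulrDr //; apply: idealD.
  - by exists (c * y); [apply: idealMl | rewrite mulrCA].
apply: (ideal_mul_ind (L := Ideal h)) => _ y /pidealP[b ->] Iy.
by exists (b * y); [apply: idealMl | rewrite mulrCA mulrA].
Qed.

(** Multiply 1 = i + j by 1 = i' + l. *)
Lemma comax_mulr I J L : I + J = 1 -> I + L = 1 -> I + J * L = 1.
Proof.
move=> IJ IL; apply: ideal_eq1.
have [i Ii Ji] : (I + J)%R 1 by rewrite IJ.
have [i' Ii' Li'] : (I + L)%R 1 by rewrite IL.
exists (1 - (1 - i) * (1 - i')); last by rewrite subKr; apply: ideal_mulM.
have -> : 1 - (1 - i) * (1 - i') = i + (1 - i) * i' by ring.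
by apply: idealD => //; apply: idealMl.
Qed.

Lemma comax_exprr I J n : I + J = 1 -> I + J ^+ n = 1.
Proof.
move=> IJ; elim: n => [|n IHn]; last by rewrite exprS; apply: comax_mulr.
by apply: ideal_eq1; apply: ideal_addSr.
Qed.

Lemma comax_prodr I (s : seq ideal) :
  (forall J, J \in s -> I + J = 1) -> I + \prod_(J <- s) J = 1.
Proof.
elim: s => [|J s IHs] h.
  by rewrite big_nil; apply: ideal_eq1; apply: ideal_addSr.
rewrite big_cons; apply: comax_mulr; first by apply: h; rewrite mem_head.
by apply: IHs => L Ls; apply: h; rewrite inE Ls orbT.
Qed.

Lemma comax_mulE I J x : I + J = 1 -> (I * J)%R x <-> I x /\ J x.
Proof.
move=> IJ; split=> [IJx|[Ix Jx]].
  by split; [apply: ideal_mulSl IJx | apply: ideal_mulSr IJx].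
have [i Ii Ji] : (I + J)%R 1 by rewrite IJ.
have -> : x = x * (1 - i) + i * x by ring.
by apply: idealD; apply: ideal_mulM.
Qed.

End IdealSemiring.
Arguments ideal_mulSl {A} I J.
Arguments ideal_mulSr {A} I J.
Arguments ideal_prod : simpl never.
Arguments ideal_add : simpl never.
Arguments pideal : simpl never.
Arguments ideal_addSl {A} I J.
Arguments ideal_addSr {A} I J.

(** * Finite residue systems *)

Section Transversal.
Variable A : comNzRingType.
Implicit Types I J : ideal A.

Definition transversal I (T : finType) (r : T -> A) :=
  (forall x, exists t, I (x - r t)) /\ (forall t u, I (r t - r u) -> t = u).

(** Residues are counted through systems of representatives indexed by finite
    types, which spares the construction of quotient rings. *)
Lemma transversal_norm I (T : finType) (r : T -> A) :
  transversal I r -> ideal_norm I = #|T|.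
Proof.
move=> [cover inj]; rewrite /ideal_norm.
have cosetE x y : I (x - y) -> ideal_coset I x = ideal_coset I y.
  move=> Ixy; apply/funext => z; apply/propext; rewrite /ideal_coset /=; split.
    by move=> h; apply: idealBtrans h Ixy.
  by move=> h; apply: idealBtrans h (idealBC Ixy).
have finR : finite_set (range (ideal_coset I)).
  apply: sub_finite_set (finite_image (ideal_coset I \o r) (@finite_finset T setT)).
  by move=> _ [x _ <-]; have [t It] := cover x; exists t => //=; rewrite (cosetE _ _ It).
have -> : fset_set (range (ideal_coset I)) =
          [fset ideal_coset I (r t) | t in T]%fset.
  apply/fsetP => S; rewrite in_fset_set //; apply/idP/imfsetP => /=.
    rewrite inE => -[x _ <-]; have [t It] := cover x; exists t => //=.
    exact: cosetE.
  by move=> [t _ ->]; rewrite inE; exists (r t).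
rewrite card_imfset /= -?cardE // => t u e; apply: inj.
have : ideal_coset I (r t) (r t) by rewrite /ideal_coset /= subrr; apply: ideal0.
by rewrite e.
Qed.

(** Keep, among the representatives of each class, the first one. *)
Lemma cover_transversal I (T0 : finType) (r0 : T0 -> A) :
  (forall x, exists t, I (x - r0 t)) ->
  exists (T : finType) (r : T -> A), transversal I r /\ (#|T| <= #|T0|)%N.
Proof.
move=> cover; pose cl t := [pick u | `[< I (r0 t - r0 u) >]].
pose T := {t : T0 | cl t == Some t}.
exists T, (fun t => r0 (val t)); split; last first.
  by rewrite card_sig; apply: max_card.
have clE t u : I (r0 t - r0 u) -> cl t = cl u.
  move=> Itu; apply: eq_pick => v; apply: asbool_equiv_eq; split.
    by apply: idealBtrans; apply: idealBC.
  exact: idealBtrans.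
split=> [x|t u Itu]; last first.
  apply: val_inj; move: (valP t) (valP u) => /eqP et /eqP eu.
  by apply: Some_inj; rewrite -et -eu; apply: clE.
have [t It] := cover x.
have [u cltu] : exists u, cl t = Some u.
  rewrite /cl; case: pickP => [u _|/(_ t)]; first by exists u.
  by rewrite subrr asboolT //; apply: ideal0.
have Itu : I (r0 t - r0 u).
  by move: cltu; rewrite /cl; case: pickP => // v /asboolP Iv [<-].
have clu : cl u == Some u by rewrite -(clE _ _ Itu) cltu.
by exists (exist _ u clu) => /=; apply: idealBtrans It Itu.
Qed.

Definition finite_index I := exists r : 'I_(ideal_norm I) -> A, transversal I r.

Lemma transversal_finite_index I (T : finType) (r : T -> A) :
  transversal I r -> finite_index I.
Proof.
move=> rI; rewrite /finite_index (transversal_norm rI); case: rI => cover inj.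
exists (fun i => r (enum_val i)); split=> [x|i j /inj/enum_val_inj //].
by have [t It] := cover x; exists (enum_rank t); rewrite enum_rankK.
Qed.

Lemma cover_finite_index I (T : finType) (r : T -> A) :
  (forall x, exists t, I (x - r t)) ->
  finite_index I /\ (ideal_norm I <= #|T|)%N.
Proof.
move=> /cover_transversal[U [s [sI leUT]]]; split.
  exact: transversal_finite_index sI.
by rewrite (transversal_norm sI).
Qed.

Lemma transversal1 : transversal (1 : ideal A) (fun _ : 'I_1 => 0).
Proof. by split=> [x|t u _]; [exists ord0 | rewrite !ord1]. Qed.

Lemma ideal_norm1 : ideal_norm (1 : ideal A) = 1%N.
Proof. by rewrite (transversal_norm transversal1) card_ord. Qed.

Lemma finite_index1 : finite_index (1 : ideal A).
Proof. exact: transversal_finite_index transversal1. Qed.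

Lemma ideal_norm_gt0 I : finite_index I -> (0 < ideal_norm I)%N.
Proof. by move=> [r [/(_ 0)[[i ltiN] _] _]]; apply: leq_ltn_trans ltiN. Qed.

Lemma finite_indexS I J :
  I `<=` J -> finite_index I -> finite_index J /\ (ideal_norm J <= ideal_norm I)%N.
Proof.
move=> IJ [r [cover _]]; rewrite -[X in (_ <= X)%N]card_ord.
by apply: (@cover_finite_index J _ r) => x; have [t /IJ Jt] := cover x; exists t.
Qed.

(** Were the norms equal, the classes modulo J would correspond one to one to
    those modulo I, and an element of J outside I would be congruent to 0
    modulo I. *)
Lemma ideal_norm_lt I J :
  I `<=` J -> I <> J -> finite_index I -> (ideal_norm J < ideal_norm I)%N.
Proof.
move=> IJ neIJ finI; have [finJ leN] := finite_indexS IJ finI.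
rewrite ltn_neqAle leN andbT; apply/negP => /eqP eN; apply: neIJ.
case: finI finJ => r [rcover rinj] [s [scover sinj]].
apply: ideal_eq => x; split=> [/IJ//|Jx].
have [f fP] := choice (fun t => rcover (s t)).
have finj : injective f.
  move=> t u eft; apply: sinj; apply: IJ.
  by apply: idealBtrans (fP t) _; rewrite eft; apply: idealBC.
have [t0 I0] := rcover 0; have [tx Ix] := rcover x.
have /bij_inj finjb : bijective f by apply: (inj_card_bij finj); rewrite !card_ord eN.
have fsurj t : exists u, f u = t.
  have bf : bijective f by apply: (inj_card_bij finj); rewrite !card_ord eN.
  by case: bf => g _ gK; exists (g t).
have [u0 fu0] := fsurj t0; have [ux fux] := fsurj tx.
have eu : u0 = ux.
  apply: sinj; apply: (@idealBtrans _ _ _ 0).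
    apply: IJ; apply: idealBtrans (fP u0) _; rewrite fu0; exact: idealBC.
  apply: (@idealBtrans _ _ _ x); first by rewrite sub0r; apply: idealN.
  apply: IJ; apply: idealBtrans Ix _; rewrite -fux; exact/idealBC/fP.
have : I (x - 0).
  by apply: idealBtrans Ix _; rewrite -fux -eu fu0; apply: idealBC.
by rewrite subr0.
Qed.

(** With 1 = i + j, the element r (1 - i) + s i is congruent to r modulo I and
    to s modulo J. *)
Lemma transversal_comax I J (T U : finType) (r : T -> A) (s : U -> A) :
  I + J = 1 -> transversal I r -> transversal J s ->
  exists rs : T * U -> A, [/\ transversal (I * J) rs,
     forall p, I (rs p - r p.1) & forall p, J (rs p - s p.2)].
Proof.
move=> IJ [rcover rinj] [scover sinj].
have [i Ii Ji] : (I + J)%R 1 by rewrite IJ.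
pose rs (p : T * U) := r p.1 * (1 - i) + s p.2 * i.
have rsr p : I (rs p - r p.1).
  have -> : rs p - r p.1 = (s p.2 - r p.1) * i by rewrite /rs; ring.
  exact: idealMl.
have rss p : J (rs p - s p.2).
  have -> : rs p - s p.2 = (r p.1 - s p.2) * (1 - i) by rewrite /rs; ring.
  exact: idealMl.
exists rs; split=> //; split=> [x|[t u] [t' u'] IJtu].
  have [t It] := rcover x; have [u Ju] := scover x; exists (t, u).
  apply/(comax_mulE _ IJ); split.
    exact: idealBtrans It (idealBC (rsr (t, u))).
  exact: idealBtrans Ju (idealBC (rss (t, u))).
have [Itu Jtu] := (comax_mulE _ IJ).1 IJtu.
congr (_, _); [apply: rinj|apply: sinj].
  apply: idealBtrans (idealBC (rsr (t, u))) _.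
  exact: idealBtrans Itu (rsr (t', u')).
apply: idealBtrans (idealBC (rss (t, u))) _.
exact: idealBtrans Jtu (rss (t', u')).
Qed.

Lemma finite_index_comax I J : I + J = 1 ->
  finite_index I -> finite_index J ->
  finite_index (I * J) /\ ideal_norm (I * J)%R = (ideal_norm I * ideal_norm J)%N.
Proof.
move=> IJ [r rI] [s sJ]; have [rs [rsIJ _ _]] := transversal_comax IJ rI sJ.
split; first exact: transversal_finite_index rsIJ.
by rewrite (transversal_norm rsIJ) card_prod !card_ord.
Qed.

(** * Means of periodic functions *)

Variable R : realType.
Implicit Types g h : A -> R.

Definition periodic I g := forall x y, I (x - y) -> g x = g y.

Definition residue_rep I : 'I_(ideal_norm I) -> A :=
  xget (fun=> 0) [set r | transversal I r].
Arguments residue_rep : clear implicits.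

(** The mean over A/I of a function that is constant on the classes modulo I;
    by [mean_modE] any transversal computes it. *)
Definition mean_mod I g : R :=
  (ideal_norm I)%:R^-1 * \sum_(t < ideal_norm I) g (residue_rep I t).

Lemma residue_repP I : finite_index I -> transversal I (residue_rep I).
Proof. exact: (xgetPex (fun=> 0)). Qed.

Lemma transversal_sum I g (T U : finType) (r : T -> A) (s : U -> A) :
  periodic I g -> transversal I r -> transversal I s ->
  \sum_t g (r t) = \sum_u g (s u).
Proof.
move=> gI [rcover rinj] [scover sinj].
have [f fP] := choice (fun t => scover (r t)).
have [f' f'P] := choice (fun u => rcover (s u)).
have fK : cancel f f'.
  by move=> t; apply: rinj; apply: idealBC; apply: idealBtrans (fP t) (f'P _).
have f'K : cancel f' f.
  by move=> u; apply: sinj; apply: idealBC; apply: idealBtrans (f'P u) (fP _).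
rewrite [RHS](reindex f) /=; last by apply: onW_bij; exists f'.
by apply: eq_bigr => t _; apply: gI.
Qed.

Lemma mean_modE I g (T : finType) (r : T -> A) :
  periodic I g -> transversal I r -> mean_mod I g = #|T|%:R^-1 * \sum_t g (r t).
Proof.
move=> gI rI; rewrite /mean_mod -(transversal_norm rI).
congr (_ * _); apply: (transversal_sum gI _ rI).
by apply: residue_repP; apply: transversal_finite_index rI.
Qed.

Lemma eq_mean_mod I g h : (forall x, g x = h x) -> mean_mod I g = mean_mod I h.
Proof. by move=> gh; congr (_ * _); apply: eq_bigr => t _. Qed.

Lemma mean_modD I g h :
  mean_mod I (fun x => g x + h x) = mean_mod I g + mean_mod I h.
Proof. by rewrite /mean_mod big_split mulrDr. Qed.

Lemma mean_modZ I c g : mean_mod I (fun x => c * g x) = c * mean_mod I g.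
Proof. by rewrite /mean_mod -mulr_sumr mulrCA. Qed.

Lemma mean_mod_sum I (T : Type) (s : seq T) (G : T -> A -> R) :
  mean_mod I (fun x => \sum_(b <- s) G b x) = \sum_(b <- s) mean_mod I (G b).
Proof. by rewrite /mean_mod exchange_big /= mulr_sumr. Qed.

Lemma mean_mod_cst I c : finite_index I -> mean_mod I (fun=> c) = c.
Proof.
move=> /ideal_norm_gt0 N0; rewrite /mean_mod sumr_const card_ord -[c *+ _]mulr_natl mulrA.
by rewrite mulVf ?mul1r // pnatr_eq0 -lt0n.
Qed.

Lemma mean_mod1 I : finite_index I -> mean_mod I (fun=> 1) = 1.
Proof. exact: mean_mod_cst. Qed.

(** Chinese remainders: conditions modulo comaximal ideals are independent. *)
Lemma mean_mod_comax I J g h : I + J = 1 -> finite_index I -> finite_index J ->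
  periodic I g -> periodic J h ->
  mean_mod (I * J) (fun x => g x * h x) = mean_mod I g * mean_mod J h.
Proof.
move=> IJ [r rI] [s sJ] gI hJ.
have [rs [rsIJ rsr rss]] := transversal_comax IJ rI sJ.
have ghIJ : periodic (I * J) (fun x => g x * h x).
  move=> x y /(comax_mulE _ IJ)[Ixy Jxy].
  by rewrite (gI _ _ Ixy) (hJ _ _ Jxy).
rewrite (mean_modE ghIJ rsIJ) (mean_modE gI rI) (mean_modE hJ sJ).
rewrite card_prod natrM invfM mulrACA; congr (_ * _).
rewrite big_distrlr /= pair_bigA /=; apply: eq_bigr => p _.
by rewrite (gI _ _ (rsr p)) (hJ _ _ (rss p)).
Qed.

Lemma periodic_prod (s : seq (ideal A)) (g : ideal A -> A -> R) :
  (forall I, I \in s -> periodic I (g I)) ->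
  periodic (\prod_(I <- s) I) (fun x => \prod_(I <- s) g I x).
Proof.
elim: s => [|I s IHs] gs x y; first by rewrite !big_nil.
rewrite !big_cons => Isxy; congr (_ * _).
  by apply: gs; [rewrite mem_head | apply: ideal_mulSl Isxy].
apply: IHs; last exact: ideal_mulSr Isxy.
by move=> J Js; apply: gs; rewrite inE Js orbT.
Qed.

Lemma finite_index_prod (s : seq (ideal A)) :
  (forall I, I \in s -> finite_index I) -> pairwise (fun I J => I + J == 1) s ->
  finite_index (\prod_(I <- s) I) /\
  ideal_norm (\prod_(I <- s) I)%R = (\prod_(I <- s) ideal_norm I)%N.
Proof.
elim: s => [|I s IHs] fins; first by rewrite !big_nil ideal_norm1; split=> //; exact: finite_index1.
rewrite /= !big_cons => /andP[/allP Is /IHs[|fin <-]].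
  by move=> J Js; apply: fins; rewrite inE Js orbT.
apply: finite_index_comax => //; last by apply: fins; rewrite mem_head.
by apply: comax_prodr => J /Is/eqP.
Qed.

Lemma mean_mod_prod (s : seq (ideal A)) (g : ideal A -> A -> R) :
  (forall I, I \in s -> finite_index I) -> pairwise (fun I J => I + J == 1) s ->
  (forall I, I \in s -> periodic I (g I)) ->
  mean_mod (\prod_(I <- s) I) (fun x => \prod_(I <- s) g I x) =
  \prod_(I <- s) mean_mod I (g I).
Proof.
elim: s => [|I s IHs] fins.
  move=> _ _; rewrite !big_nil -[RHS](mean_mod1 finite_index1).
  by apply: eq_mean_mod => x; rewrite big_nil.
move=> cox gs; have := cox; rewrite /= => /andP[/allP Is coxs].
have fins' J : J \in s -> finite_index J by move=> Js; apply: fins; rewrite inE Js orbT.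
have gs' J : J \in s -> periodic J (g J) by move=> Js; apply: gs; rewrite inE Js orbT.
rewrite !big_cons -IHs // -mean_mod_comax //.
- by apply: eq_mean_mod => x; rewrite big_cons.
- by apply: comax_prodr => J /Is/eqP.
- by apply: fins; rewrite mem_head.
- by have [] := finite_index_prod fins' coxs.
- by apply: gs; rewrite mem_head.
- exact: periodic_prod.
Qed.

Lemma periodic_mem I b : periodic I (fun x => (`[< I (x + b) >])%:R).
Proof.
move=> x y Ixy; congr (_%:R); congr nat_of_bool; apply: asbool_equiv_eq; split.
  move=> h; have -> : y + b = x + b + - (x - y) by ring.
  by apply: idealB.
move=> h; have -> : x + b = x - y + (y + b) by ring.
exact: idealD.
Qed.

Lemma mean_mod_mem I b : finite_index I ->
  mean_mod I (fun x => (`[< I (x + b) >])%:R) = (ideal_norm I)%:R^-1.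
Proof.
move=> finI; have [cover inj] := residue_repP finI; rewrite /mean_mod.
have [t It] := cover (- b).
rewrite (bigD1 t) //= big1 ?addr0 => [|u ut].
  have -> : `[< I (residue_rep I t + b) >] by apply/asboolP; rewrite -[b]opprK; exact: idealBC.
  by rewrite mulr1.
rewrite asboolF // => Iu; case/negP: ut; apply/eqP; apply: inj.
by apply: idealBtrans It; rewrite opprK.
Qed.

End Transversal.
Arguments residue_rep {A} I _.

(** * The ring of integers: domain, finite residue rings, normality *)

Section RingOfIntegersFacts.
Variable K : fieldExtType rat.
Local Notation OK := (ringOfIntegers K).
Implicit Types (a b x y : OK) (I J : ideal OK).

Lemma int_val_inj : injective (@int_val K). Proof. exact: val_inj. Qed.

Lemma OK_domain x y : x * y = 0 -> x <> 0 -> y = 0.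
Proof.
move=> xy0 x0; apply: int_val_inj; move/(congr1 (@int_val K))/eqP: xy0.
rewrite [int_val (x * y)]/(val x * val y) mulf_eq0 => /orP[/eqP vx0|/eqP->//].
by case: x0; apply: int_val_inj.
Qed.

Definition int_horner (p : {poly int}) a : OK := (map_poly intr p).[a].

Lemma int_horner_root a : exists2 p : {poly int}, p != 0 & int_horner p a = 0.
Proof.
have /asboolP[p p_mon /rootP pa0] := int_valP a.
exists p; first exact: monic_neq0.
apply: int_val_inj; rewrite -[RHS]/(0 : K) -pa0 /int_horner.
rewrite -[LHS]/((val : {rmorphism OK -> K}) _) -horner_map -map_poly_comp.
by congr _.[_]; apply: eq_map_poly => z; apply: (rmorph_int (val : {rmorphism OK -> K})).
Qed.

(** Strip factors X from an integer polynomial vanishing at a: the remaining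
    constant term is a nonzero multiple of a. *)
Lemma dvd_pos_nat a : a <> 0 -> exists2 m : nat, (0 < m)%N & exists b, a * b = m%:R.
Proof.
move=> a0; have [p + pa0] := int_horner_root a.
elim/poly_ind: p pa0 => [|p c IHp]; first by rewrite eqxx.
rewrite /int_horner rmorphD rmorphM /= map_polyX map_polyC hornerMXaddC /=.
rewrite -/(int_horner p a) => pac0 pc0.
have [c0|c0] := eqVneq c 0.
  apply: IHp; last by apply: contra_neq pc0 => ->; rewrite c0 mul0r polyC0 add0r.
  apply: (@OK_domain a) => //; move: pac0.
  by rewrite c0 addr0 mulrC.
exists `|c|%N; first by rewrite absz_gt0.
exists (- (sgz c)%:~R * int_horner p a).
have -> : a * (- (sgz c)%:~R * int_horner p a) = (sgz c)%:~R * - (int_horner p a * a) by ring.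
have -> : - (int_horner p a * a) = c%:~R by move/eqP: pac0; rewrite addr_eq0 => /eqP->; rewrite opprK.
have e : sgz c * c = (`|c|%N)%:Z by case: sgzP => h; lia.
by rewrite -intrM e.
Qed.

Lemma sum_pidealP (A : comNzRingType) n (u : nat -> A) z :
  (\sum_(i < n) pideal (u i))%R z -> exists c : nat -> A, z = \sum_(i < n) c i * u i.
Proof.
elim: n z => [|n IHn] z; first by rewrite big_ord0 => /ideal0E->; exists (fun=> 0); rewrite big_ord0.
rewrite big_ord_recr /= => -[y /IHn[c ->] /pidealP[b /eqP]].
rewrite subr_eq => /eqP ->; exists (fun i => if i == n then b else c i).
rewrite big_ord_recr /= eqxx addrC; congr (_ + _); apply: eq_bigr => i _.
by rewrite ltn_eqF.
Qed.

(** An infinite ascending chain of ideals of finite index would have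
    infinitely decreasing norms. *)
Lemma ideal_chain_stable (A : comNzRingType) (L : nat -> ideal A) :
  (forall n, L n `<=` L n.+1) -> finite_index (L 0%N) -> exists n, L n.+1 = L n.
Proof.
move=> mono fin0.
have finL n : finite_index (L n).
  by elim: n => // n IHn; have [] := finite_indexS (mono n) IHn.
apply: contrapT => strict.
suff h n : (ideal_norm (L n) + n <= ideal_norm (L 0%N))%N.
  have := h (ideal_norm (L 0%N)).+1; lia.
elim: n => [|n IHn]; first by rewrite addn0.
rewrite addnS; apply: leq_trans IHn; rewrite ltn_add2r.
apply: ideal_norm_lt (mono n) _ (finL n).
by move=> eL; apply: strict; exists n.
Qed.

(** If b/a maps I into itself, the ideals spanned by the iterates of b/a on a
    nonzero element of I stabilise, which gives a monic equation for b/a over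
    the ring of integers; hence b/a is integral. *)
Lemma OK_normal I a b : (forall J : ideal OK, J <> 0 -> finite_index J) ->
  I <> 0 -> a <> 0 -> (forall x, I x -> exists2 y, I y & b * x = a * y) ->
  pideal a b.
Proof.
move=> finOK /ideal_neq0[x0 Ix0 x0n0] a0 bI.
have /choice[f fP] x : exists y, I x -> I y /\ b * x = a * y.
  have [/bI[y Iy e]|nIx] := pselect (I x); first by exists y.
  by exists 0.
pose u n := iter n f x0.
have Iu n : I (u n) by elim: n => // n IHn /=; have [] := fP _ IHn.
have uS n : b * u n = a * u n.+1 by have [] := fP _ (Iu n).
pose L n := \sum_(i < n.+1) pideal (u i).
have [n Ln] : exists n, L n.+1 = L n.
  apply: ideal_chain_stable => [n|].
    by rewrite /L [X in _ `<=` ideal_set X]big_ord_recr; apply: ideal_addSl.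
  apply: finOK => L0; apply: x0n0; apply: ideal0E; rewrite -L0 /L big_ord1.
  exact: pideal_id.
have : L n.+1 (u n.+1).
  by rewrite /L big_ord_recr; apply: ideal_addSr; apply: pideal_id.
rewrite Ln => /sum_pidealP[c uc].
pose g : K := val b / val a.
have va0 : val a != 0 by apply/eqP => va0; apply: a0; apply: int_val_inj.
have vu i : val (u i) = g ^+ i * val x0.
  elim: i => [|i IHi]; first by rewrite mul1r.
  apply: (mulfI va0); rewrite -[LHS]/(val (a * u i.+1)) -uS.
  rewrite -[LHS]/(val b * val (u i)) IHi exprS /g.
  by field.
have vx0 : val x0 != 0 by apply/eqP => v0; apply: x0n0; apply: int_val_inj.
pose p : {poly K} := 'X^(n.+1) - \poly_(i < n.+1) val (c i).
have p_mon : p \is monic.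
  rewrite monicE /p lead_coefDl ?lead_coefXn //.
  by rewrite size_polyN size_polyXn ltnS size_poly.
have pg0 : root p g.
  apply/rootP; rewrite /p hornerD hornerN hornerXn horner_poly.
  apply/eqP; rewrite subr_eq0; apply/eqP; apply: (mulIf vx0).
  rewrite -vu uc [LHS](rmorph_sum (val : {rmorphism OK -> K})) mulr_suml.
  by apply: eq_bigr => i _; rewrite rmorphM /= vu mulrA.
have g_int : integralOver (intr : int -> K) g.
  apply: (integral_root_monic p_mon pg0); apply/integral_poly => i.
  rewrite coefB coefXn coef_poly; apply: integral_sub; first exact: integral_nat.
  by case: ifP => _; [apply/asboolP/int_valP | exact: (integral_nat _ 0)].
apply/pidealP; exists (RingOfIntegers (introT (asboolP _) g_int)).
by apply: int_val_inj; rewrite -[RHS]/(g * val a) /g divfK.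
Qed.

End RingOfIntegersFacts.

Section Coordinates.
Variables (K : fieldExtType rat) (d : nat).
Local Notation OK := (ringOfIntegers K).
Variable iota : {additive 'rV[int]_d -> OK}.
Hypothesis iota_bij : bijective iota.

Definition coord (a : OK) : 'rV[int]_d := 'pinv_(fun=> 0) [set: 'rV[int]_d] iota a.

Lemma iotaK : cancel iota coord.
Proof. by move=> v; apply: pinvKV; rewrite ?inE //; apply: in2W (bij_inj iota_bij). Qed.

Lemma coordK : cancel coord iota.
Proof. by have [g _ gK] := iota_bij; move=> a; rewrite -[a in LHS]gK iotaK gK. Qed.

Lemma coord0 : coord 0 = 0. Proof. by rewrite -(raddf0 iota) iotaK. Qed.
Lemma coordD x y : coord (x + y) = coord x + coord y.
Proof. by apply: (bij_inj iota_bij); rewrite raddfD !coordK. Qed.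
Lemma coordN x : coord (- x) = - coord x.
Proof. by apply: (bij_inj iota_bij); rewrite raddfN !coordK. Qed.
(** Reduce the coordinates modulo m. *)
Lemma nat_ideal_finite (I : ideal OK) (m : nat) : (0 < m)%N -> I m%:R ->
  finite_index I /\ (ideal_norm I <= m ^ d)%N.
Proof.
move=> m_gt0 Im; pose r (t : {ffun 'I_d -> 'I_m}) := iota (\row_i (t i)%:Z).
have [x|fI le] := @cover_finite_index _ I _ r; last first.
  by split=> //; move: le; rewrite card_ffun !card_ord.
have lt_mod z : (`|(z %% m%:Z)%Z| < m)%N.
  by have := ltz_pmod z (d := m%:Z); have := modz_ge0 z (d := m%:Z); lia.
exists [ffun i => Ordinal (lt_mod (coord x 0 i))].
rewrite -[x in x - _]coordK -raddfB.
have -> : coord x - \row_i (([ffun i => Ordinal (lt_mod (coord x 0 i))] i : 'I_m) : nat)%:Z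
       = (\row_i divz (coord x 0 i) m%:Z) *+ m.
  apply/rowP => i; rewrite !mxE ffunE /= mulmxnE mxE.
  have := divz_eq (coord x 0 i) m; have := modz_ge0 (coord x 0 i) (d := m%:Z); lia.
by rewrite raddfMn -mulr_natr; apply: idealMl.
Qed.

Lemma OK_finite_index (I : ideal OK) : I <> 0 -> finite_index I.
Proof.
move=> /ideal_neq0[a Ia a0]; have [m m_gt0 [b ab]] := dvd_pos_nat a0.
by have [] := @nat_ideal_finite I m m_gt0; rewrite -?ab //; apply: idealMr.
Qed.

End Coordinates.

(** * Factorisation of ideals *)

Section Dedekind.
Variable A : comNzRingType.
Implicit Types (x y a b : A) (I J P Q X : ideal A).

Definition nzprime P := is_prime_ideal P /\ P <> 0.

Lemma nzprime_neq0 P : nzprime P -> P <> 0. Proof. by case. Qed.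

Lemma nzprime1 P : nzprime P -> ~ P 1.
Proof. by move=> [[[_ /negP P1 _] _] _] P1'; apply: P1; apply: mem_set. Qed.

Lemma nzprime_neq1 P : nzprime P -> P <> 1.
Proof. by move=> /nzprime1 + P1; rewrite P1; apply. Qed.

Lemma nzprimeM P x y : nzprime P -> P (x * y) -> P x \/ P y.
Proof.
move=> [[_ pP] _] Pxy.
by have /orP[/set_mem|/set_mem] := pP x y (mem_set Pxy); [left|right].
Qed.

Lemma nzprimeI P : P <> 0 -> ~ P 1 -> (forall x y, P (x * y) -> P x \/ P y) ->
  nzprime P.
Proof.
move=> P0 P1 PM; split=> //; split.
  split=> [|| a x y]; [exact/mem_set/ideal0 | by apply/negP => /set_mem/P1|].
  move=> /set_mem Px /set_mem Py; apply: mem_set; apply: idealD => //.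
  exact: idealMl.
by move=> x y /set_mem/PM[?|?]; apply/orP; [left|right]; apply: mem_set.
Qed.

Hypothesis A_domain : forall x y, x * y = 0 -> x <> 0 -> y = 0.
Hypothesis A_finite : forall I, I <> 0 -> finite_index I.
Hypothesis A_normal : forall I a b, I <> 0 -> a <> 0 ->
  (forall x, I x -> exists2 y, I y & b * x = a * y) -> pideal a b.

(** Strictly larger ideals have strictly smaller norms: induction from the
    large ideals down to the small ones. *)
Lemma ideal_norm_ind (Pr : ideal A -> Prop) :
  (forall I, I <> 0 -> (forall J, I `<=` J -> I <> J -> Pr J) -> Pr I) ->
  forall I, I <> 0 -> Pr I.
Proof.
move=> IH I; move: {2}(ideal_norm I).+1 (ltnSn (ideal_norm I)) => n.
elim: n I => // n IHn I ltn I0; apply: IH => // J IJ neIJ.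
apply: IHn; last exact: ideal_neq0W I0 IJ.
exact: leq_trans (ideal_norm_lt IJ neIJ (A_finite I0)) ltn.
Qed.

Lemma not_prime_split I : I <> 0 -> I <> 1 -> ~ nzprime I ->
  exists x y, [/\ I (x * y), ~ I x & ~ I y].
Proof.
move=> I0 I1 nprI; apply: contrapT => h; apply: nprI; apply: nzprimeI => //.
  by move/ideal_eq1.
move=> x y Ixy; apply: contrapT => /not_orP[nIx nIy].
by apply: h; exists x, y.
Qed.

Lemma add_pideal_mul I x y : I (x * y) -> (I + pideal x) * (I + pideal y) `<=` I.
Proof.
move=> Ixy; apply: ideal_mul_ind => u v.
move=> [i Ii /pidealP[a /eqP]]; rewrite subr_eq => /eqP ->.
move=> [j Ij /pidealP[b /eqP]]; rewrite subr_eq => /eqP ->.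
have -> : (a * x + i) * (b * y + j) = a * b * (x * y) + (a * x + i) * j + (b * y) * i by ring.
by do 2?apply: idealD; apply: idealMl.
Qed.

Lemma add_pideal_neq I x : ~ I x -> I <> I + pideal x.
Proof. by move=> nIx eI; apply: nIx; rewrite eI; apply: ideal_addSr; apply: pideal_id. Qed.

(** If I is not prime, with x y in I, the ideals I + (x) and I + (y) are not
    both the whole ring, since their product lies in I. *)
Lemma sub_nzprime I : I <> 0 -> I <> 1 -> exists2 P, nzprime P & I `<=` P.
Proof.
move: I; apply: (ideal_norm_ind (Pr := fun I => I <> 1 -> exists2 P, nzprime P & I `<=` P)).
move=> I I0 IH I1; have [prI|nprI] := pselect (nzprime I); first by exists I.
have [x [y [Ixy nIx nIy]]] := not_prime_split I0 I1 nprI.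
suff [z [nIz z1]] : exists z, ~ I z /\ I + pideal z <> 1.
  have [P prP sP] := IH _ (ideal_addSl I (pideal z)) (add_pideal_neq nIz) z1.
  by exists P => // u Iu; apply: sP; apply: ideal_addSl.
apply: contrapT => h; apply: I1; apply: ideal_eq1; apply: (add_pideal_mul Ixy).
have e z : ~ I z -> I + pideal z = 1.
  by move=> nIz; apply: contrapT => z1; apply: h; exists z.
by rewrite !e // mul1r.
Qed.

Lemma prod_nzprimes_sub I : I <> 0 ->
  exists2 s : seq (ideal A), (forall Q, Q \in s -> nzprime Q) & \prod_(Q <- s) Q `<=` I.
Proof.
move: I; apply: ideal_norm_ind => I I0 IH.
have [->|I1] := pselect (I = 1); first by exists [::].
have [prI|nprI] := pselect (nzprime I).
  by exists [:: I] => [Q|]; [rewrite inE => /eqP-> | rewrite big_seq1].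
have [x [y [Ixy nIx nIy]]] := not_prime_split I0 I1 nprI.
have [s prs ss] := IH _ (ideal_addSl I (pideal x)) (add_pideal_neq nIx).
have [t prt st] := IH _ (ideal_addSl I (pideal y)) (add_pideal_neq nIy).
exists (s ++ t) => [Q|]; first by rewrite mem_cat => /orP[/prs|/prt].
by rewrite big_cat => u /(ideal_mulS ss st)/(add_pideal_mul Ixy).
Qed.

(** A finite domain is a field. *)
Lemma nzprime_max P J : nzprime P -> P `<=` J -> J = P \/ J = 1.
Proof.
move=> prP PJ; have [JP|nJP] := pselect (J `<=` P).
  by left; apply: ideal_eq => x; split=> [/JP|/PJ].
right; have [x Jx nPx] : exists2 x, J x & ~ P x.
  by apply: contrapT => h; apply: nJP => x Jx; apply: contrapT => nPx; apply: h; exists x.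
have [r [cover inj]] := A_finite (nzprime_neq0 prP).
have [f fP] := choice (fun t => cover (x * r t)).
have finj : injective f.
  move=> t u eft; apply: inj.
  have : P (x * (r t - r u)).
    rewrite mulrBr; apply: idealBtrans (fP t) _; rewrite eft; exact: idealBC.
  by case/(nzprimeM prP).
have [g _ gK] : bijective f by apply: injF_bij.
have [t Pt] := cover 1; apply: ideal_eq1.
rewrite -(subrK (x * r (g t)) 1); apply: idealD; last exact: idealMr.
by apply: PJ; apply: idealBtrans Pt _; rewrite -{1}(gK t); apply: idealBC.
Qed.

Lemma nzprime_mul_sub P I J : nzprime P -> I * J `<=` P -> I `<=` P \/ J `<=` P.
Proof.
move=> prP IJP; apply: contrapT => /not_orP[/existsNP[x /not_implyP[Ix nPx]]].
move=> /existsNP[y /not_implyP[Jy nPy]].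
by have := IJP _ (ideal_mulM Ix Jy); case/(nzprimeM prP).
Qed.

Lemma nzprime_prod_sub P (s : seq (ideal A)) : nzprime P ->
  \prod_(Q <- s) Q `<=` P -> exists2 Q, Q \in s & Q `<=` P.
Proof.
move=> prP; elim: s => [|Q s IHs].
  by rewrite big_nil => /(_ 1 (ideal1E _))/(nzprime1 prP).
rewrite big_cons => /(nzprime_mul_sub prP)[QP|/IHs[Q' Q's Q'P]].
  by exists Q; rewrite ?mem_head.
by exists Q'; rewrite ?inE ?Q's ?orbT.
Qed.

Lemma nzprime_sub_eq P Q : nzprime P -> nzprime Q -> P `<=` Q -> P = Q.
Proof. by move=> prP prQ /(nzprime_max prP)[->//|/(nzprime_neq1 prQ)]. Qed.

Lemma nzprime_comax P Q : nzprime P -> nzprime Q -> P <> Q -> P + Q = 1.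
Proof.
move=> prP prQ PQ; case: (nzprime_max prP (ideal_addSl P Q)) => // e.
by case: PQ; apply/esym/nzprime_sub_eq => //; rewrite -e; apply: ideal_addSr.
Qed.

(** A product of primes lies in (a), hence in P, so that P is one of the
    factors. If the product of the others still lies in (a), drop P and start
    again; otherwise this product contains b outside (a), and b P lies in (a). *)
Lemma nzprime_witness P a : nzprime P -> a <> 0 -> P a ->
  exists2 b, ~ pideal a b & forall x, P x -> pideal a (b * x).
Proof.
move=> prP a0 Pa.
have [s prs ss] : exists2 s : seq (ideal A),
    (forall Q, Q \in s -> nzprime Q) & \prod_(Q <- s) Q `<=` pideal a.
  by apply: prod_nzprimes_sub => a0'; apply: a0; apply: ideal0E; rewrite -a0'; apply: pideal_id.
move: {2}(size s).+1 (ltnSn (size s)) => n.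
elim: n s prs ss => // n IHn s prs ss lts.
have sP : \prod_(Q <- s) Q `<=` P by move=> x /ss; apply: ((@pidealS A P a).2 Pa).
have [Q Qs QP] := nzprime_prod_sub prP sP.
have Ps : P \in s by rewrite -(nzprime_sub_eq (prs _ Qs) prP QP).
have ers : \prod_(Q <- s) Q = P * \prod_(Q <- rem P s) Q.
  by rewrite (perm_big _ (perm_to_rem Ps)) big_cons.
have [ss'|/existsNP[b /not_implyP[sb nab]]] := pselect (\prod_(Q <- rem P s) Q `<=` pideal a).
  apply: (IHn (rem P s)) => //; first by move=> Q' /mem_rem/prs.
  by rewrite size_rem //; case: (s) Ps lts.
exists b => // x Px; apply: ss; rewrite ers [b * x]mulrC; exact: ideal_mulM.
Qed.

Definition invertible I := exists J a, a <> 0 /\ I * J = pideal a.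

Lemma pideal_inj a I J : a <> 0 -> pideal a * I = pideal a * J -> I = J.
Proof.
move=> a0; have sub X Y : pideal a * X = pideal a * Y -> X `<=` Y.
  move=> e x Xx; have : (pideal a * X)%R (a * x) by apply/pidealMP; exists x.
  rewrite e => /pidealMP[y Yy /eqP]; rewrite -subr_eq0 -mulrBr => /eqP.
  by move/A_domain => /(_ a0)/eqP; rewrite subr_eq0 => /eqP->.
by move=> e; apply: ideal_eq => x; split; apply: sub.
Qed.

Lemma invertible_inj I X Y : invertible I -> I * X = I * Y -> X = Y.
Proof.
move=> [J [a [a0 IJ]]] e; apply: (pideal_inj a0).
by rewrite -IJ mulrAC e mulrAC.
Qed.

(** To be contained in a principal ideal is to be divisible by it. *)
Lemma pideal_factor I a : I `<=` pideal a -> I = pideal a * colon I a.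
Proof.
move=> Ia; apply: ideal_eq => x; split=> [Ix|/pidealMP[y Iy ->] //].
have /pidealP[b xb] := Ia _ Ix; apply/pidealMP; exists b; last by rewrite mulrC.
by rewrite /colon /= mulrC -xb.
Qed.

(** Let J be the set of x with x P inside (a), which contains a and the witness
    b. The ideal P J / a lies between P and the whole ring; it is not P, since
    b/a would then map P into itself and be integral. *)
Lemma nzprime_invertible P : nzprime P -> invertible P.
Proof.
move=> prP; have [a Pa a0] := ideal_neq0 (nzprime_neq0 prP).
have [b nab bP] := nzprime_witness prP a0 Pa.
have hJ : is_ideal [set x | forall y, P y -> pideal a (x * y)].
  split=> [y _|x x' hx hx' y Py|c x hx y Py].
  - by rewrite mul0r; apply: ideal0.
  - by rewrite mulrDl; apply: idealD; [apply: hx | apply: hx'].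
  - by rewrite -mulrA; apply: idealMl; apply: hx.
pose J := Ideal hJ.
have Ja : J a by move=> y _; apply: idealMr; apply: pideal_id.
have PJa : P * J `<=` pideal a.
  by apply: ideal_mul_ind => x y Px Jy; rewrite mulrC; apply: Jy.
have PX : P `<=` colon (P * J) a.
  move=> x Px; rewrite -[colon _ _ _]/((P * J)%R (a * x)) [a * x]mulrC.
  exact: ideal_mulM.
exists J, a; split=> //; rewrite (pideal_factor PJa).
case: (nzprime_max prP PX) => [eX|->]; last by rewrite mulr1.
case: nab; apply: (A_normal (nzprime_neq0 prP) a0) => x Px.
have : (P * J)%R (b * x) by rewrite [b * x]mulrC; apply: ideal_mulM => //; apply: bP.
by rewrite (pideal_factor PJa) eX => /pidealMP[y Py ->]; exists y.
Qed.

Lemma ideal_mul_neq0 I J : I <> 0 -> J <> 0 -> I * J <> 0.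
Proof.
move=> /ideal_neq0[x Ix x0] /ideal_neq0[y Jy y0] IJ0.
have : (I * J)%R (x * y) by apply: ideal_mulM.
by rewrite IJ0 => /ideal0E/A_domain/(_ x0).
Qed.

(** Divide I J by a, where P J = (a). If the quotient were I itself, every j/a
    with j in J would map I into itself, hence J would lie in (a). *)
Lemma nzprime_divides P I : nzprime P -> I <> 0 -> I `<=` P ->
  exists2 X, I = P * X & I <> X.
Proof.
move=> prP I0 IP; have [J [a [a0 PJ]]] := nzprime_invertible prP.
have IJa : I * J `<=` pideal a by rewrite -PJ; apply: ideal_mulS.
have IJX := pideal_factor IJa; set X := colon (I * J) a in IJX.
have PX : I = P * X.
  by apply: (pideal_inj a0); rewrite [RHS]mulrCA -IJX [RHS]mulrCA PJ mulrC.
exists X => // eIX; apply: (nzprime1 prP).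
have Ja : J `<=` pideal a.
  move=> j Jj; apply: (A_normal I0 a0) => x Ix.
  have : (I * J)%R (j * x) by rewrite [j * x]mulrC; apply: ideal_mulM.
  by rewrite IJX -eIX => /pidealMP[y Iy ->]; exists y.
have e : P * colon J a = 1.
  by apply: (pideal_inj a0); rewrite mulrCA -(pideal_factor Ja) mulr1.
by apply: (ideal_mulSl P (colon J a)); rewrite e.
Qed.

Lemma ideal_factorization I : I <> 0 ->
  exists2 s : seq (ideal A), (forall Q, Q \in s -> nzprime Q) & I = \prod_(Q <- s) Q.
Proof.
move: I; apply: ideal_norm_ind => I I0 IH.
have [->|I1] := pselect (I = 1); first by exists [::]; rewrite ?big_nil.
have [P prP IP] := sub_nzprime I0 I1.
have [X eI neX] := nzprime_divides prP I0 IP.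
have IX : I `<=` X by move=> u; rewrite eI; apply: ideal_mulSr.
have [s prs eX] := IH _ IX neX; exists (P :: s); last by rewrite big_cons -eX.
by move=> Q; rewrite inE => /orP[/eqP->|/prs].
Qed.

Lemma invertibleM I J : invertible I -> invertible J -> invertible (I * J).
Proof.
move=> [I' [a [a0 eI]]] [J' [b [b0 eJ]]]; exists (I' * J'), (a * b); split.
  by move=> /A_domain/(_ a0).
rewrite mulrACA eI eJ; apply: ideal_eq => x; split.
  by move=> /pidealMP[y /pidealP[c ->] ->]; apply/pidealP; exists c; ring.
move=> /pidealP[c ->]; apply/pidealMP; exists (c * b); last by ring.
by apply/pidealP; exists c.
Qed.

Lemma ideal_invertible I : I <> 0 -> invertible I.
Proof.
move=> /ideal_factorization[s + ->]; elim: s => [|P s IHs] prs.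
  rewrite big_nil; exists 1, 1; split; first exact/eqP/oner_neq0.
  by rewrite mulr1; apply/esym/ideal_eq1/pideal_id.
rewrite big_cons; apply: invertibleM.
  by apply: nzprime_invertible; apply: prs; rewrite mem_head.
by apply: IHs => Q Qs; apply: prs; rewrite inE Qs orbT.
Qed.

(** X/PX is a line over the field A/P: any x in X outside PX spans it, because
    no ideal lies strictly between PX and X. *)
Lemma ideal_norm_mul_prime P X : nzprime P -> X <> 0 ->
  ideal_norm (P * X)%R = (ideal_norm P * ideal_norm X)%N.
Proof.
move=> prP X0; have invX := ideal_invertible X0.
have [x Xx nPXx] : exists2 x, X x & ~ (P * X)%R x.
  apply: contrapT => h; apply: (nzprime_neq1 prP); apply: (invertible_inj invX).
  rewrite mulr1 mulrC; apply: ideal_eq => x; split; first exact: ideal_mulSr.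
  by move=> Xx; apply: contrapT => nPXx; apply: h; exists x.
pose Y := pideal x + P * X.
have YX : Y `<=` X.
  move=> y [u /pidealP[b ->]] /(ideal_mulSr P X) h; rewrite -(subrK (b * x) y).
  by apply: idealD => //; apply: idealMl.
have eY : Y = X.
  have [X' [c [c0 XX']]] := invX.
  have YX'c : Y * X' `<=` pideal c by rewrite -XX'; apply: ideal_mulS.
  have eYX' := pideal_factor YX'c.
  have PZ : P `<=` colon (Y * X') c.
    move=> p Pp; apply: (@ideal_mulS _ (P * X) Y X' X') => //; first exact: ideal_addSr.
    by rewrite -mulrA XX' [c * p]mulrC; apply: ideal_mulM => //; apply: pideal_id.
  case: (nzprime_max prP PZ) => eZ; rewrite eZ in eYX'.
    case: nPXx; suff <- : Y = P * X by apply: ideal_addSl; apply: pideal_id.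
    apply: (pideal_inj c0); rewrite -{1}XX' -mulrA [X' * Y]mulrC eYX'.
    by rewrite mulrCA [X * P]mulrC.
  apply: (@invertible_inj X'); first by exists X, c; rewrite mulrC.
  by rewrite mulrC eYX' mulr1 mulrC XX'.
have [r [rcover rinj]] := A_finite X0.
have [s [scover sinj]] := A_finite (nzprime_neq0 prP).
pose rs (p : 'I_(ideal_norm P) * 'I_(ideal_norm X)) := r p.2 + x * s p.1.
have rsT : transversal (P * X) rs.
  split=> [y|[u t] [u' t'] h].
    have [t Xt] := rcover y; move: Xt; rewrite -{1}eY => -[_ /pidealP[a ->] h].
    have [u Pu] := scover a; exists (u, t); rewrite -[rs _]/(r t + x * s u).
    have -> : y - (r t + x * s u) = (y - r t - a * x) + (a - s u) * x by ring.
    by apply: idealD => //; apply: ideal_mulM.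
  rewrite -[rs _]/(r t + x * s u) -[rs (u', t')]/(r t' + x * s u') in h.
  have ett' : t = t'.
    apply: rinj; have -> : r t - r t' = (r t + x * s u - (r t' + x * s u')) + (s u' - s u) * x by ring.
    by apply: idealD; [apply: ideal_mulSr h | apply: idealMl].
  subst t'; congr (_, _); apply: sinj.
  have cx : colon (P * X) x (s u - s u').
    rewrite -[colon _ _ _]/((P * X)%R (x * (s u - s u'))).
    by have -> : x * (s u - s u') = r t + x * s u - (r t + x * s u') by ring.
  have Pc : P `<=` colon (P * X) x.
    move=> p Pp; rewrite -[colon _ _ _]/((P * X)%R (x * p)) [x * p]mulrC; exact: ideal_mulM.
  case: (nzprime_max prP Pc) => [<- //|e1]; case: nPXx.
  have : colon (P * X) x 1 by rewrite e1.
  by rewrite -[colon _ _ _]/((P * X)%R (x * 1)) mulr1.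
by rewrite (transversal_norm rsT) card_prod !card_ord.
Qed.

Lemma ideal_prod_neq0 (s : seq (ideal A)) :
  (forall Q, Q \in s -> Q <> 0) -> \prod_(Q <- s) Q <> 0.
Proof.
elim: s => [|P s IHs] s0.
  by rewrite big_nil => e; have /eqP := oner_neq0 A; apply; apply: ideal0E; rewrite -e.
rewrite big_cons; apply: ideal_mul_neq0; first by apply: s0; rewrite mem_head.
by apply: IHs => Q Qs; apply: s0; rewrite inE Qs orbT.
Qed.

Lemma ideal_normM I J : I <> 0 -> J <> 0 ->
  ideal_norm (I * J)%R = (ideal_norm I * ideal_norm J)%N.
Proof.
move=> /ideal_factorization[s prs ->] J0; elim: s prs => [|P s IHs] prs.
  by rewrite big_nil mul1r ideal_norm1 mul1n.
have prP : nzprime P by apply: prs; rewrite mem_head.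
have prs' Q : Q \in s -> nzprime Q by move=> Qs; apply: prs; rewrite inE Qs orbT.
have s0 : \prod_(Q <- s) Q <> 0 by apply: ideal_prod_neq0 => Q /prs'/nzprime_neq0.
rewrite big_cons -mulrA !(ideal_norm_mul_prime prP) //; last exact: ideal_mul_neq0.
by rewrite IHs // mulnA.
Qed.

Lemma ideal_exp_neq0 I n : I <> 0 -> I ^+ n <> 0.
Proof.
move=> I0; elim: n => [|n IHn]; last by rewrite exprS; apply: ideal_mul_neq0.
by rewrite expr0 => e; have /eqP := oner_neq0 A; apply; apply: ideal0E; rewrite -e.
Qed.

Lemma ideal_normX I n : I <> 0 -> ideal_norm (I ^+ n)%R = (ideal_norm I ^ n)%N.
Proof.
move=> I0; elim: n => [|n IHn]; first by rewrite ideal_norm1.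
by rewrite exprS expnS ideal_normM ?IHn //; apply: ideal_exp_neq0.
Qed.

End Dedekind.

(** * Lattice points in balls *)

Lemma inj_card_fset_set (T : choiceType) (F : finType) (S : set T) (f : T -> F) :
  {in S &, injective f} -> finite_set S /\ (#|` fset_set S| <= #|F|)%N.
Proof.
move=> finj.
have finS : finite_set S by rewrite -(eq_finite_set (inj_card_eq finj)); apply: finite_finset.
split=> //.
have finj' : {in fset_set S &, injective f}.
  by move=> x y; rewrite !in_fset_set //; apply: finj.
rewrite -(card_in_imfset imfset_key finj') /= -card_finset.
by apply: fsubset_leq_card; apply/fsubsetP => y _; rewrite !inE.
Qed.

Lemma sum_mem_card (T : choiceType) (X : {fset T}) (p : pred T) :
  (\sum_(x <- X) p x)%N = #|` [fset x in X | p x]%fset|.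
Proof.
rewrite -sum1_size [RHS](perm_big [seq x <- X | p x]) /=.
  by rewrite big_filter [RHS]big_mkcond; apply: eq_bigr => x _; case: (p x).
apply: uniq_perm; rewrite ?filter_uniq ?fset_uniq // => x.
by rewrite !inE mem_filter andbC.
Qed.

(** The quotients (a + j) / h jump exactly at the multiples of h, so the count
    telescopes. *)
Lemma count_multiples (h a L : nat) : (0 < h)%N ->
  (L %/ h <= \sum_(j < L) (h %| (a + j).+1) <= (L %/ h).+1)%N.
Proof.
move=> h0; have -> : (\sum_(j < L) (h %| (a + j).+1) = (a + L) %/ h - a %/ h)%N.
  elim: L => [|L IHL]; first by rewrite big_ord0 addn0 subnn.
  have := leq_div2r h (leq_addr L a).
  by rewrite big_ord_recr /= IHL addnS divnS //; lia.
rewrite divnD //; move: (a %/ h)%N (L %/ h)%N => q r.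
by case: (h <= _)%N; rewrite /=; lia.
Qed.

Section Lattice.
Variables (K : fieldExtType rat) (d : nat).
Local Notation OK := (ringOfIntegers K).
Variable iota : {additive 'rV[int]_d -> OK}.
Hypothesis iota_bij : bijective iota.
Local Notation coord := (coord iota).
Let coordK := coordK iota_bij.
Let iotaK := iotaK iota_bij.

Lemma rank_gt0 : (0 < d)%N.
Proof.
rewrite lt0n; apply/eqP => d0; have /eqP := oner_neq0 OK; apply.
rewrite -[1]coordK -[0]coordK; congr (iota _).
by apply/rowP => i; have := ltn_ord i; rewrite [X in (_ < X)%N]d0.
Qed.

Definition cof (a : OK) (i : 'I_d) : int := coord a 0 i.

Lemma cof_inj a b : (forall i, cof a i = cof b i) -> a = b.
Proof.
by move=> e; rewrite -[a]coordK -[b]coordK; congr (iota _); apply/rowP => i; apply: e.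
Qed.

Lemma cof_iota v i : cof (iota v) i = v 0 i. Proof. by rewrite /cof iotaK. Qed.
Lemma cof0 i : cof 0 i = 0. Proof. by rewrite /cof coord0 // mxE. Qed.
Lemma cofD a b i : cof (a + b) i = cof a i + cof b i.
Proof. by rewrite /cof coordD // mxE. Qed.
Lemma cofN a i : cof (- a) i = - cof a i.
Proof. by rewrite /cof coordN // mxE. Qed.
Lemma cofMz a z i : cof (a *~ z) i = z * cof a i.
Proof. by rewrite -[a in LHS]coordK -raddfMz cof_iota -scaler_int mxE intz. Qed.

Definition nrm (a : OK) : nat := (\sum_(i < d) `|cof a i|)%N.

Lemma nrmE a : nrm a = (\sum_(i < d) `|cof a i|)%N. Proof. by []. Qed.

Lemma cof_le a i : (`|cof a i| <= nrm a)%N.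
Proof. by rewrite /nrm (bigD1 i) //= leq_addr. Qed.

Lemma nrm0 : nrm 0 = 0%N.
Proof. by rewrite /nrm big1 // => i _; rewrite cof0. Qed.

Lemma nrm_eq0 a : nrm a = 0%N -> a = 0.
Proof. by move=> a0; apply: cof_inj => i; have := cof_le a i; rewrite cof0; lia. Qed.

Lemma nrmD a b : (nrm (a + b)%R <= nrm a + nrm b)%N.
Proof.
by rewrite /nrm -big_split /=; apply: leq_sum => i _; rewrite cofD; lia.
Qed.

Lemma nrm_sum (T : Type) (s : seq T) (P : pred T) (F : T -> OK) :
  (nrm (\sum_(i <- s | P i) F i)%R <= \sum_(i <- s | P i) nrm (F i))%N.
Proof.
apply: (big_ind2 (fun a m => nrm a <= m)%N) => //; first by rewrite nrm0.
by move=> a m b n am bn; apply: leq_trans (nrmD _ _) (leq_add am bn).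
Qed.

Lemma nrmMz a (z : int) : nrm (a *~ z) = (`|z| * nrm a)%N.
Proof.
by rewrite /nrm big_distrr /=; apply: eq_bigr => i _; rewrite cofMz abszM.
Qed.

Definition ball (n : nat) : {fset OK} := fset_set [set a | (nrm a <= n)%N].

(** Cells of side s: with s = 1 they separate the points of a ball, and larger
    sides separate the points of a sparse lattice. *)
Definition cell (n s : nat) (a : OK) : {ffun 'I_d -> 'I_(2 * n %/ s).+1} :=
  [ffun i => inord (`|(cof a i + n%:Z)%R| %/ s)].

Lemma cell_eq n s a b i : (0 < s)%N -> (nrm a <= n)%N -> (nrm b <= n)%N ->
  cell n s a = cell n s b -> (`|cof a i - cof b i| < s)%N.
Proof.
move=> s0 an bn /ffunP/(_ i)/(congr1 val); rewrite !ffunE.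
have ai := leq_trans (cof_le a i) an; have bi := leq_trans (cof_le b i) bn.
rewrite /= !inordK ?ltnS ?leq_div2r //; [|lia..].
set u := absz _; set v := absz (cof b i + _)%R => e.
have := divn_eq u s; have := divn_eq v s; rewrite -e.
have := ltn_pmod u s0; have := ltn_pmod v s0; rewrite {e}.
set q := (u %/ s * s)%N; rewrite /u /v; lia.
Qed.

Lemma cell1_inj n : {in [set a | (nrm a <= n)%N] &, injective (cell n 1)}.
Proof.
move=> a b /set_mem /= an /set_mem /= bn e.
apply: cof_inj => i; have := cell_eq i _ an bn e; lia.
Qed.

Lemma mem_ball n a : (a \in ball n) = (nrm a <= n)%N.
Proof.
have [fin _] := inj_card_fset_set (@cell1_inj n).
by rewrite in_fset_set //; apply/idP/idP; rewrite inE.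
Qed.

Lemma ball_card_le n : (#|` ball n| <= (2 * n).+1 ^ d)%N.
Proof.
have [_ le] := inj_card_fset_set (@cell1_inj n).
by apply: leq_trans le _; rewrite card_ffun !card_ord divn1.
Qed.

Lemma ball_card_ge n : (n ^ d <= d ^ d * #|` ball n|)%N.
Proof.
(* The cube with coordinates in [0, n/d] lies in the ball. *)
pose f (t : {ffun 'I_d -> 'I_(n %/ d).+1}) := iota (\row_i (t i)%:Z).
have finj : injective f.
  move=> t u /(bij_inj iota_bij)/rowP e; apply/ffunP => i; apply: val_inj.
  by have := e i; rewrite !mxE => -[].
have : ((n %/ d).+1 ^ d <= #|` ball n|)%N.
  rewrite -{1}[(n %/ d).+1]card_ord -[d in (_ ^ d)%N]card_ord -card_ffun.
  have -> : #|{ffun 'I_d -> 'I_(n %/ d).+1}| = #|` [fset f t | t in {ffun 'I_d -> 'I_(n %/ d).+1}]%fset|.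
    by rewrite card_imfset //= -cardE.
  apply: fsubset_leq_card; apply/fsubsetP => _ /imfsetP[t _ ->]; rewrite mem_ball.
  apply: (@leq_trans (\sum_(i < d) n %/ d)%N); last by rewrite sum_nat_const card_ord mulnC leq_divM.
  by apply: leq_sum => i _; rewrite cof_iota mxE absz_nat -ltnS ltn_ord.
move=> /(leq_mul (leqnn (d ^ d))); apply: leq_trans.
by rewrite -expnMn leq_exp2r ?rank_gt0 // ltnW // mulnC ltn_ceil ?rank_gt0.
Qed.

Lemma ball_card_gt0 n : (0 < #|` ball n|)%N.
Proof. by rewrite cardfs_gt0; apply/fset0Pn; exists 0; rewrite mem_ball nrm0. Qed.

End Lattice.

(** * Equidistribution of balls among cosets *)

Section Discrepancy.
Variables (K : fieldExtType rat) (d : nat).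
Local Notation OK := (ringOfIntegers K).
Variable iota : {additive 'rV[int]_d -> OK}.
Hypothesis iota_bij : bijective iota.
Local Notation nrm := (nrm iota).
Local Notation cof := (cof iota).
Local Notation ball := (ball iota).
Implicit Types (G : ideal OK) (i : 'I_d).

Definition basis i : OK := iota (delta_mx 0 i).

Lemma cof_basis i j : cof (basis i) j = (j == i)%:R.
Proof. by rewrite cof_iota // mxE eqxx. Qed.

Lemma cof_addMz a i (z : int) j : cof (a + basis i *~ z) j = cof a j + (j == i)%:R * z.
Proof. by rewrite cofD // cofMz // cof_basis mulrC. Qed.

Lemma sum_basis a : a = \sum_i basis i *~ cof a i.
Proof.
apply: (cof_inj iota_bij) => j.
rewrite (big_morph (cof^~ j) (fun a b => cofD iota_bij a b j) (cof0 iota_bij j)).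
rewrite (bigD1 j) //= big1 => [|i ij]; rewrite cofMz // cof_basis.
  by rewrite eqxx mulr1 addr0.
by rewrite eq_sym (negPf ij) mulr0.
Qed.

Definition hits G (n : nat) (c : OK) : nat :=
  (\sum_(x <- ball n) `[< G (x - c)%R >])%N.

Definition axis_slice n i : {fset OK} := [fset y in ball n | cof y i == 0]%fset.

Lemma axis_slice_card n i : (#|` axis_slice n i| <= (2 * n).+1 ^ d.-1)%N.
Proof.
pose f (a : OK) : {ffun 'I_d.-1 -> 'I_(2 * n).+1} :=
  [ffun j => inord `|(cof a (lift i j) + n%:Z)%R| ].
have finj : {in axis_slice n i &, injective f}.
  move=> a b; rewrite !inE !mem_ball // => /andP[an /eqP ai] /andP[bn /eqP bi] /ffunP e.
  apply: (cof_inj iota_bij) => j; case: (unliftP i j) => [j' ->|->]; last by rewrite ai bi.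
  have := congr1 val (e j'); rewrite !ffunE /=.
  have := leq_trans (cof_le iota a (lift i j')) an.
  have := leq_trans (cof_le iota b (lift i j')) bn.
  by move=> h1 h2; rewrite !inordK; lia.
rewrite -(card_in_imfset imfset_key finj) /=.
apply: (@leq_trans #|{ffun 'I_d.-1 -> 'I_(2 * n).+1}|); last by rewrite card_ffun !card_ord.
rewrite -card_finset.
by apply: fsubset_leq_card; apply/fsubsetP => y _; rewrite !inE.
Qed.

(** A ball is a union of intervals parallel to a coordinate axis. *)
Lemma ball_slices (F : OK -> nat) n i :
  (\sum_(x <- ball n) F x = \sum_(y <- axis_slice n i)
     \sum_(j < (2 * (n - nrm y)).+1) F (y + basis i *~ (j%:Z - (n - nrm y)%:Z))%R)%N.
Proof.
pose g (y : OK) (j : nat) := y + basis i *~ (j%:Z - (n - nrm y)%:Z).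
have gi y j : y \in axis_slice n i -> cof (g y j) i = j%:Z - (n - nrm y)%:Z.
  by rewrite !inE => /andP[_ /eqP yi]; rewrite cof_addMz yi eqxx mul1r add0r.
have gj y j k : k != i -> cof (g y j) k = cof y k.
  by move=> ki; rewrite cof_addMz (negPf ki) mul0r addr0.
pose rest a := (\sum_(k < d | k != i) `|cof a k|)%N.
have nrm_split a : nrm a = (`|cof a i| + rest a)%N by rewrite nrmE (bigD1 i).
have eq_rest a b : (forall k, k != i -> cof a k = cof b k) -> rest a = rest b.
  by move=> e; apply: eq_bigr => k ki; rewrite e.
pose r (y : OK) := index_iota 0 (2 * (n - nrm y)).+1.
transitivity (\sum_(x <- [seq g y j | y <- axis_slice n i, j <- r y]) F x)%N.
  apply: perm_big; apply: uniq_perm; first exact: fset_uniq.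
    apply: allpairs_uniq_dep => [|y _|]; [exact: fset_uniq|exact: iota_uniq|].
    move=> [y j] [y' j'] /allpairsPdep[y1 [j1 [sy _ ey]]].
    move=> /allpairsPdep[y1' [j1' [sy' _ ey']]] /= e.
    have {y1 j1 ey}sy : y \in axis_slice n i by move/(congr1 tag): ey => /= ->.
    have {y1' j1' ey'}sy' : y' \in axis_slice n i by move/(congr1 tag): ey' => /= ->.
    have eyy : y = y'.
      apply: (cof_inj iota_bij) => k; have [->|ki] := eqVneq k i.
        by move: sy sy'; rewrite !inE => /andP[_ /eqP->] /andP[_ /eqP->].
      by rewrite -(gj y j k ki) e gj.
    by subst y'; have := gi y j sy; rewrite e gi // => ejj; congr existT; lia.
  move=> x; rewrite mem_ball //; apply/idP/allpairsPdep => [xn|[y [j [sy]]]].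
    pose y := x - basis i *~ cof x i.
    have ey k : cof y k = cof x k - (k == i)%:R * cof x i.
      by rewrite /y -mulrNz cof_addMz mulrN.
    have yi : cof y i = 0 by rewrite ey eqxx mul1r subrr.
    have ny : nrm y = rest x.
      rewrite nrm_split yi /= add0n; apply: eq_rest => k ki.
      by rewrite ey (negPf ki) mul0r subr0.
    have := nrm_split x => nx.
    exists y, `|(cof x i + (n - nrm y)%:Z)%R|%N; split.
    - by rewrite !inE mem_ball // yi eqxx andbT ny; lia.
    - by rewrite mem_index_iota; lia.
    apply: (cof_inj iota_bij) => k; rewrite cof_addMz ey.
    have -> : `|(cof x i + (n - nrm y)%:Z)%R|%N%:Z - (n - nrm y)%:Z = cof x i by lia.
    by rewrite subrK.
  have yi : cof y i = 0 by move: sy; rewrite !inE => /andP[_ /eqP].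
  rewrite mem_index_iota => /andP[_ jr] ->.
  rewrite nrm_split gi // (eq_rest _ y) => [|k]; last exact: gj.
  by move: sy jr; rewrite !inE mem_ball // => /andP[]; rewrite nrm_split yi; lia.
rewrite big_allpairs_dep /=; apply: eq_bigr => y _.
by rewrite /r big_mkord.
Qed.

(** The multiples of a basis vector lying in G form a nonzero subgroup of Z. *)
Lemma axis_step G i : G <> 0 ->
  exists2 h : nat, (0 < h)%N & forall z : int, G (basis i *~ z) <-> (h %| `|z|)%N.
Proof.
move=> /ideal_neq0[a Ga a0].
have [m m_gt0 [b ab]] := dvd_pos_nat a0.
have Gm : G (basis i *~ m) by rewrite -mulrzl -[m%:~R]/(m%:R) -ab -mulrA; apply: idealMr.
have exP : exists m : nat, (0 < m)%N && `[< G (basis i *~ m) >].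
  by exists m; rewrite m_gt0; apply/asboolP.
have GMz (c z : int) : G (basis i *~ z) -> G (basis i *~ (c * z)).
  by rewrite mulrC mulrzA => h; rewrite -mulrzl; apply: idealMl.
case: (ex_minnP exP) => h /andP[h0 /asboolP Gh] hmin; exists h => // z; split => [Gz|].
  have : (z %% h)%Z = 0.
    have := modz_ge0 z (d := h); have := ltz_pmod z (d := h).
    case er : (z %% h)%Z => [r|r]; last by lia.
    move=> ltr _; case: r er ltr => // r er ltr.
    have /hmin : (0 < r.+1)%N && `[< G (basis i *~ r.+1) >]; last by lia.
    apply/andP; split=> //; apply/asboolP; rewrite -er /modz mulrzBr.
    by apply: idealB => //; apply: GMz.
  by move/dvdz_mod0P; rewrite dvdzE.
rewrite -[h in (h %| _)%N]absz_nat -dvdzE => /dvdzP[c ->]; exact: GMz.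
Qed.

(** On a line parallel to an axis, a coset of G is empty or a residue class
    modulo a step h that depends only on G and the axis, so that an interval of
    length L contains L/h of its points up to rounding. *)
Lemma line_hits G i u (z w : int) L : G <> 0 ->
  (\sum_(j < L) `[< G (u + basis i *~ (j%:Z + z))%R >] <=
   (\sum_(j < L) `[< G (u + basis i *~ (j%:Z + w))%R >]).+1)%N.
Proof.
move=> /(axis_step i)[h h0 hG].
have [[z0 Gz0]|none] := pselect (exists z0, G (u + basis i *~ z0)); last first.
  by rewrite big1 // => j _; rewrite asboolF // => Gj; apply: none; exists (j%:Z + z).
suff count (y : int) : exists a : nat,
    (\sum_(j < L) `[< G (u + basis i *~ (j%:Z + y))%R >] =
     \sum_(j < L) (h %| (a + j).+1))%N.
  have [a ->] := count z; have [b ->] := count w.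
  have := count_multiples a L h0; have := count_multiples b L h0; lia.
(* The offset -1 turns j + y - z0 into a successor, as in count_multiples. *)
have [a ea] : exists a : nat, ((y - z0 - 1) %% h)%Z = a.
  have := modz_ge0 (y - z0 - 1) (d := h).
  by case: (modz _ _) => [a|a]; [exists a | lia].
exists a; apply: eq_bigr => j _; congr nat_of_bool.
apply: (asbool_equiv_eqP idP).
have -> : (h %| (a + j).+1)%N = (h %| `|(j%:Z + y - z0)%R|)%N.
  rewrite -[LHS]/(h %| (a + j).+1%:Z)%Z -[RHS]/(h %| (j%:Z + y - z0)%R)%Z.
  have -> : j%:Z + y - z0 = (a + j).+1%:Z + ((y - z0 - 1) %/ h)%Z * h.
    have := divz_eq (y - z0 - 1) h; rewrite ea; lia.
  by rewrite rpredDr // dvdz_mull.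
rewrite -hG; split => [Gj|].
  have -> : basis i *~ (j%:Z + y - z0) = u + basis i *~ (j%:Z + y) - (u + basis i *~ z0).
    by rewrite mulrzBr; ring.
  exact: idealB.
move=> Gj; have -> : u + basis i *~ (j%:Z + y) = basis i *~ (j%:Z + y - z0) + (u + basis i *~ z0).
  by rewrite mulrzBr; ring.
exact: idealD.
Qed.

Lemma hits_axis_shift G n c i (z : int) : G <> 0 ->
  (hits G n (c + basis i *~ z)%R <= hits G n c + (2 * n).+1 ^ d.-1)%N.
Proof.
move=> G0; rewrite /hits !(ball_slices _ n i).
apply: leq_trans (leq_add (leqnn _) (axis_slice_card n i)).
rewrite -sum1_size -big_split /= ; apply: leq_sum => y _.
rewrite addn1; set L := (_).+1; set r := (n - nrm y)%N.
have := line_hits i (y - c) (- r%:Z - z) (- r%:Z) L G0.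
congr (_ <= _.+1)%N; apply: eq_bigr => j _; congr nat_of_bool; congr (`[< G _ >]).
  by rewrite !mulrzDr !mulrNz; ring.
by rewrite !mulrzDr !mulrNz; ring.
Qed.

(** Move from c to c' along the coordinate axes, one after the other. *)
Lemma hits_shift G n c c' : G <> 0 ->
  (hits G n c' <= hits G n c + d * (2 * n).+1 ^ d.-1)%N.
Proof.
move=> G0; have -> : c' = c + (c' - c) by ring.
rewrite {1}(sum_basis (c' - c)).
have h (s : seq 'I_d) : (hits G n (c + \sum_(i <- s) basis i *~ cof (c' - c) i)%R <=
    hits G n c + size s * (2 * n).+1 ^ d.-1)%N.
  elim: s => [|i s IHs]; first by rewrite big_nil addr0 addn0.
  rewrite big_cons [_ *~ _ + _]addrC addrA [size _]/= mulSn.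
  by apply: leq_trans (hits_axis_shift _ _ _ _ G0) _; rewrite addnCA addnC leq_add2l.
by have := h (index_enum 'I_d); rewrite [size _](_ : _ = d) // -[RHS]card_ord cardT enumT.
Qed.

Variable R : realType.

(** The counts of a ball in two cosets of G differ by O(n^(d-1)): moving along
    one coordinate axis changes the count by at most one per axis-parallel
    line, uniformly in G. Hence each coset receives its fair share. *)
Lemma hits_equidistributed G n c : G <> 0 ->
  `|(hits G n c)%:R - #|` ball n|%:R / (ideal_norm G)%:R|
     <= (d * (2 * n).+1 ^ d.-1)%:R :> R.
Proof.
move=> G0; have finG := OK_finite_index iota_bij G0.
have Ngt0 := ideal_norm_gt0 finG; have [r [rcover rinj]] := finG.
have total : #|` ball n| = (\sum_t hits G n (r t))%N.
  rewrite -sum1_size /hits exchange_big /=; apply: eq_bigr => x _.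
  have [t Gt] := rcover x; rewrite (bigD1 t) //= big1 ?addn0; first by rewrite asboolT.
  move=> u ut; rewrite asboolF // => Gu; case/negP: ut; apply/eqP; apply: rinj.
  exact: idealBtrans (idealBC Gu) Gt.
set D := (d * _)%N; set N := ideal_norm G in Ngt0 r rcover rinj total *.
have sumN x : (\sum_(t < N) x = N * x)%N by rewrite sum_nat_const card_ord.
have le1 : (#|` ball n| <= N * (hits G n c + D))%N.
  rewrite total -sumN; apply: leq_sum => t _; exact: hits_shift.
have le2 : (N * hits G n c <= #|` ball n| + N * D)%N.
  rewrite total -!sumN -big_split /=.
  by apply: leq_sum => t _; apply: hits_shift.
have N0 : 0 < N%:R :> R by rewrite ltr0n.
clearbody D N; move: le1 le2; rewrite -!(ler_nat R) !(natrD, natrM) => le1 le2.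
have : N%:R * (#|` ball n|%:R / N%:R) = #|` ball n|%:R :> R by field; rewrite gt_eqF.
set q := _ / _ => eq; rewrite ler_norml; apply/andP.
by split; rewrite -(ler_pM2l N0); lra.
Qed.

End Discrepancy.

(** * Few nonzero elements of an ideal in a ball *)

Lemma rescale_residue (A : comNzRingType) (x w a b : A) (m : nat) :
  a * b = m%:R -> (x - w * a) *~ m = a * (x * b - w *~ m).
Proof. by move=> ab; rewrite -[LHS]mulrzr -[w *~ m]mulrzr -[m%:~R]/(m%:R) -ab; ring. Qed.

Lemma sum_ord_const (d c : nat) : (\sum_(i < d) c = d * c)%N.
Proof. by rewrite sum_nat_const card_ord. Qed.

Section SparseIdeals.
Variables (K : fieldExtType rat) (d : nat).
Local Notation OK := (ringOfIntegers K).
Variable iota : {additive 'rV[int]_d -> OK}.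
Hypothesis iota_bij : bijective iota.
Local Notation nrm := (nrm iota).
Local Notation cof := (cof iota).
Local Notation ball := (ball iota).
Local Notation basis := (basis iota).
Implicit Types (I : ideal OK).

Definition mul_cst : nat := (\sum_(i < d) \sum_(j < d) nrm (basis i * basis j)%R)%N.

Lemma nrmM a b : (nrm (a * b)%R <= mul_cst * (nrm a * nrm b))%N.
Proof.
have -> : a * b = \sum_i \sum_j (basis i * basis j) *~ (cof a i * cof b j).
  rewrite {1}(sum_basis iota_bij a) {1}(sum_basis iota_bij b) big_distrlr /=.
  apply: eq_bigr => i _; apply: eq_bigr => j _.
  by rewrite mulrzAl mulrzAr mulrzA_C.
have lec i j : (nrm (basis i * basis j)%R <= mul_cst)%N.
  by rewrite /mul_cst (bigD1 i) //= (bigD1 j) //= -addnA leq_addr.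
rewrite [nrm a]nrmE [nrm b]nrmE big_distrlr /= big_distrr /=.
apply: leq_trans (nrm_sum iota_bij _ _ _) _; apply: leq_sum => i _.
rewrite big_distrr /=; apply: leq_trans (nrm_sum iota_bij _ _ _) _; apply: leq_sum => j _.
by rewrite nrmMz // abszM mulnC leq_mul.
Qed.

(** Division with remainder in coordinates: if a b = m is a positive integer,
    rounding the coordinates of x b / m reduces x modulo (a) to size O(|a|). *)
Lemma ideal_norm_le I a : I a -> a <> 0 ->
  (ideal_norm I <= (2 * (mul_cst * d * nrm a)).+1 ^ d)%N.
Proof.
move=> Ia a0; have [m m_gt0 [b ab]] := dvd_pos_nat a0.
set rho := (mul_cst * d * nrm a)%N.
have [x|_ le] := @cover_finite_index _ I (ball rho) val; last first.
  by apply: leq_trans le _; rewrite -cardfE; apply: ball_card_le.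
pose w := iota (\row_i divz (cof (x * b) i) m).
pose t := iota (\row_i modz (cof (x * b) i) m).
have e : x * b - w *~ m = t.
  apply: (cof_inj iota_bij) => i; rewrite cofD // cofN // cofMz // !cof_iota // !mxE.
  by rewrite /modz [m%:Z * _]mulrC.
have er : (x - w * a) *~ m = a * t.
  by rewrite -e; apply: rescale_residue.
have le_rho : (nrm (x - w * a)%R <= rho)%N.
  rewrite -(leq_pmul2l m_gt0).
  have -> : (m * nrm (x - w * a)%R = nrm ((x - w * a) *~ m)%R)%N by rewrite nrmMz.
  rewrite er; apply: leq_trans (nrmM _ _) _.
  have ler : (nrm t <= d * m)%N.
    rewrite -sum_ord_const; apply: leq_sum => i _.
    rewrite cof_iota // mxE; have := ltz_pmod (cof (x * b) i) (d := m).
    have := modz_ge0 (cof (x * b) i) (d := m); lia.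
  apply: leq_trans (leq_mul (leqnn _) (leq_mul (leqnn _) ler)) _.
  by rewrite /rho; nia.
have inb : x - w * a \in ball rho by rewrite mem_ball.
exists [` inb]%fset => /=; rewrite opprB addrC subrK.
exact: idealMl.
Qed.

(** A shortest nonzero vector of I has length at least a constant times
    N(I)^(1/d), so the cells of a grid of this scale separate I. *)
Lemma ideal_ball_sparse : exists C : nat, forall I n, I <> 0 ->
  (ideal_norm I * (\sum_(x <- ball n) `[< I x /\ x <> 0%R >]) <= C * n ^ d)%N.
Proof.
have d_gt0 := rank_gt0 iota_bij.
exists ((2 * mul_cst * d).+1 ^ d * (3 * d) ^ d)%N => I n I0.
have exP : exists l, `[< exists a, [/\ I a, a <> 0 & nrm a = l] >].
  have [a Ia a0] := ideal_neq0 I0.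
  by exists (nrm a); apply/asboolP; exists a.
case: (ex_minnP exP) => l /asboolP[a [Ia a0 al]] lmin.
have l_gt0 : (0 < l)%N by rewrite lt0n -al; apply/eqP => /(nrm_eq0 iota_bij).
have short x : I x -> (nrm x < l)%N -> x = 0.
  move=> Ix ltx; apply: contrapT => x0; move: ltx; rewrite ltnNge lmin //.
  by apply/asboolP; exists x.
have leN : (ideal_norm I <= ((2 * mul_cst * d).+1 * l) ^ d)%N.
  by apply: leq_trans (ideal_norm_le Ia a0) _; rewrite al leq_exp2r //; nia.
have [ltnl|leln] := ltnP n l.
  rewrite big_seq big1 ?muln0 // => x; rewrite mem_ball // => xn.
  by rewrite asboolF // => -[Ix x0]; apply: x0; apply: short Ix _; apply: leq_ltn_trans ltnl.
(* The side s is l/d rounded up: points of I in a common cell differ by less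
   than the length l of the shortest vector, hence coincide. *)
pose s := (l.-1 %/ d).+1.
have sd : (d * s.-1 < l <= d * s)%N.
  rewrite /s /=; have := divn_eq l.-1 d; have := ltn_pmod l.-1 d_gt0.
  by rewrite mulnSr [(d * _)%N]mulnC; lia.
have le_cells : (\sum_(x <- ball n) `[< I x /\ x <> 0%R >] <= (2 * n %/ s).+1 ^ d)%N.
  pose S := [fset x in ball n | `[< I x /\ x <> 0%R >]]%fset.
  rewrite sum_mem_card -/S.
  have finj : {in S &, injective (cell iota n s)}.
    move=> x y; rewrite !inE !mem_ball // => /andP[xn /asboolP[Ix _]] /andP[yn /asboolP[Iy _]] e.
    apply/eqP; rewrite -subr_eq0; apply/eqP; apply: short; first exact: idealB.
    apply: (@leq_ltn_trans (d * s.-1)%N); last by case/andP: sd.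
    rewrite -sum_ord_const; apply: leq_sum => i _.
    rewrite cofD // cofN //.
    by have := cell_eq i (ltn0Sn _) xn yn e.
  rewrite -(card_in_imfset imfset_key finj) /=.
  apply: (@leq_trans #|{ffun 'I_d -> 'I_(2 * n %/ s).+1}|); last by rewrite card_ffun !card_ord.
  rewrite -card_finset.
  by apply: fsubset_leq_card; apply/fsubsetP => y _; rewrite !inE.
apply: leq_trans (leq_mul leN le_cells) _.
rewrite expnMn -!mulnA leq_mul2l -!expnMn; apply/orP; right.
rewrite leq_exp2r //.
have := leq_divM (2 * n) s; case/andP: sd => _ lds.
set q := (2 * n %/ s)%N => qs; nia.
Qed.

End SparseIdeals.

(** * Counting primes by their least positive integer *)

Section Primes.
Variables (K : fieldExtType rat) (d : nat).
Local Notation OK := (ringOfIntegers K).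
Variable iota : {additive 'rV[int]_d -> OK}.
Hypothesis iota_bij : bijective iota.
Implicit Types (I J P Q X : ideal OK).

Let dom := @OK_domain K.
Let fin := OK_finite_index iota_bij.
Let nor := fun I a b => @OK_normal K I a b fin.

(** Every nonzero ideal contains a positive integer. Grouping the primes by the
    least one replaces the factorisation of rational primes: few primes share
    it, and it bounds the norm from below. *)
Definition least_pos I (m : nat) :=
  [/\ (0 < m)%N, I m%:R & forall j, (0 < j < m)%N -> ~ I j%:R].

Lemma least_pos_exists I : I <> 0 -> exists m, least_pos I m.
Proof.
move=> /ideal_neq0[a Ia a0]; have [m m_gt0 [b ab]] := dvd_pos_nat a0.
have exP : exists m, (0 < m)%N && `[< I m%:R >].
  by exists m; rewrite m_gt0; apply/asboolP; rewrite -ab; apply: idealMr.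
case: (ex_minnP exP) => n /andP[n0 /asboolP In] nmin; exists n; split=> // j /andP[j0 ltj] Ij.
by move: ltj; rewrite ltnNge nmin // j0; apply/asboolP.
Qed.

Lemma least_pos_fun I m n : least_pos I m -> least_pos I n -> m = n.
Proof.
move=> [m0 Im mmin] [n0 In nmin]; case: (ltngtP m n) => // h.
  by case: (nmin m); rewrite // m0.
by case: (mmin n); rewrite // n0.
Qed.

Lemma least_pos_prime_gt1 P m : nzprime P -> least_pos P m -> (1 < m)%N.
Proof. by move=> prP [m0 Pm _]; case: m m0 Pm => [|[|m]] // _ /(nzprime1 prP). Qed.

(** The integers 0, ..., m - 1 are pairwise incongruent modulo I. *)
Lemma least_pos_norm I m : I <> 0 -> least_pos I m -> (m <= ideal_norm I)%N.
Proof.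
move=> I0 [m0 Im mmin]; have [r [cover inj]] := fin I0.
have [f fP] := choice (fun j : 'I_m => cover (j%:R)).
suff finj : injective f by have := leq_card f finj; rewrite !card_ord.
move=> i j eij; apply: val_inj => /=.
have Iij : I (i%:R - j%:R).
  by apply: idealBtrans (fP i) _; rewrite eij; apply: idealBC.
case: (ltngtP i j) => // lt.
  case: (mmin (j - i)%N); first by have := ltn_ord j; lia.
  by rewrite natrB ?(ltnW lt) //; apply: idealBC.
case: (mmin (i - j)%N); first by have := ltn_ord i; lia.
by rewrite natrB ?(ltnW lt).
Qed.

Lemma nzprimes_pairwise_comax (s : seq (ideal OK)) :
  (forall P, P \in s -> nzprime P) -> uniq s -> pairwise (fun I J => I + J == 1) s.
Proof.
elim: s => //= P s IHs prs /andP[Ps us]; apply/andP; split; last first.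
  by apply: IHs => // Q Qs; apply: prs; rewrite inE Qs orbT.
apply/allP => Q Qs; apply/eqP; apply: (nzprime_comax fin).
- by apply: prs; rewrite mem_head.
- by apply: prs; rewrite inE Qs orbT.
- by move=> ePQ; rewrite ePQ Qs in Ps.
Qed.

Lemma comax_pow I J n : I + J = 1 -> I ^+ n + J ^+ n = 1.
Proof.
by move=> IJ; apply: comax_exprr; rewrite addrC; apply: comax_exprr; rewrite addrC.
Qed.

Lemma comax_prod_mem (s : seq (ideal OK)) x : pairwise (fun I J => I + J == 1) s ->
  (forall I, I \in s -> I x) -> (\prod_(I <- s) I)%R x.
Proof.
elim: s => [|I s IHs] /=; first by rewrite big_nil.
move=> /andP[/allP Is cs] hx; rewrite big_cons; apply/comax_mulE.
  by apply: comax_prodr => J /Is/eqP.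
split; first by apply: hx; rewrite mem_head.
by apply: IHs => // J Js; apply: hx; rewrite inE Js orbT.
Qed.

(** Distinct primes containing m: their product contains m and has norm at
    least m to their number, while OK/(m) has m^d elements. *)
Lemma primes_at_bound m (s : seq (ideal OK)) : uniq s ->
  (forall P, P \in s -> nzprime P /\ least_pos P m) -> (size s <= d)%N.
Proof.
case: s => // P0 s0; set s := P0 :: s0 => us sP.
have [prP0 lp0] := sP P0 (mem_head _ _).
have m1 := least_pos_prime_gt1 prP0 lp0.
have prs P : P \in s -> nzprime P by case/sP.
have cs := nzprimes_pairwise_comax prs us.
have fins P : P \in s -> finite_index P by move=> /prs/nzprime_neq0; apply: fin.
have [finp eN] := finite_index_prod fins cs.
have sm : (\prod_(P <- s) P)%R m%:R by apply: comax_prod_mem => // P /sP[_ []].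
have [_ leN] := nat_ideal_finite iota_bij (ltnW m1) sm.
rewrite -(leq_exp2l _ _ m1); apply: leq_trans leN; rewrite eN.
rewrite -[size s](count_predT s) -[X in (X <= _)%N]mul1n.
elim: (s) sP => [|P t IHt] tP; first by rewrite big_nil muln1.
rewrite big_cons /= mul1n add1n expnS; apply: leq_mul.
  by have [prP lp] := tP P (mem_head _ _); apply: least_pos_norm lp; apply: nzprime_neq0.
by rewrite -[X in (X <= _)%N]mul1n IHt // => Q Qt; apply: tP; rewrite inE Qt orbT.
Qed.

Definition primes_at (m : nat) : {fset ideal OK} :=
  fset_set [set P | nzprime P /\ least_pos P m].

Lemma mem_primes_at m P : P \in primes_at m <-> nzprime P /\ least_pos P m.
Proof.
have finS : finite_set [set P | nzprime P /\ least_pos P m].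
  apply: contrapT => /(infinite_set_fset d.+1)[B BS ltd].
  have := primes_at_bound (fset_uniq B) (fun Q QB => BS Q QB).
  by rewrite leqNgt ltd.
by rewrite in_fset_set //; split => [/set_mem|/mem_set].
Qed.

Lemma primes_at_card m : (#|` primes_at m| <= d)%N.
Proof. by apply: (@primes_at_bound m) => [|P /mem_primes_at]; rewrite ?fset_uniq. Qed.

Definition primes_between (y z : nat) : seq (ideal OK) :=
  flatten [seq enum_fset (primes_at m) | m <- index_iota y z].

Lemma mem_primes_between y z P :
  P \in primes_between y z <-> nzprime P /\ exists2 m, (y <= m < z)%N & least_pos P m.
Proof.
split=> [/flattenP[_ /mapP[m + ->]] /mem_primes_at[prP lp]|[prP [m mz lp]]].
  by rewrite mem_index_iota => mz; split=> //; exists m.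
apply/flattenP; exists (enum_fset (primes_at m)); last exact/mem_primes_at.
by apply/mapP; exists m; rewrite ?mem_index_iota.
Qed.

Lemma primes_between_uniq y z : uniq (primes_between y z).
Proof.
have : uniq (index_iota y z) by apply: iota_uniq.
rewrite /primes_between; elim: (index_iota y z) => //= m s IHs /andP[ms us].
rewrite cat_uniq fset_uniq IHs // andbT; apply/hasPn => P /flattenP[_ /mapP[n ns ->]].
move=> /mem_primes_at[_ lpn]; apply/negP => /mem_primes_at[_ lpm].
by rewrite (least_pos_fun lpm lpn) ns in ms.
Qed.

Lemma primes_between_cat x y z : (x <= y <= z)%N ->
  primes_between x z = primes_between x y ++ primes_between y z.
Proof.
move=> /andP[xy yz]; rewrite /primes_between -flatten_cat -map_cat.
by rewrite /index_iota -{2}(subnKC xy) -iotaD; congr (flatten (map _ (seq.iota _ _))); lia.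
Qed.

Definition primes_below (y : nat) : seq (ideal OK) := primes_between 0 y.

Lemma primes_belowP y P : P \in primes_below y -> nzprime P.
Proof. by move=> /mem_primes_between[]. Qed.

Lemma nzprimes_below (s : seq (ideal OK)) : (forall P, P \in s -> nzprime P) ->
  exists y, {subset s <= primes_below y}.
Proof.
elim: s => [|P s IHs] prs; first by exists 0%N.
have [y sy] : exists y, {subset s <= primes_below y}.
  by apply: IHs => Q Qs; apply: prs; rewrite inE Qs orbT.
have prP : nzprime P by apply: prs; rewrite mem_head.
have [m lp] := least_pos_exists (nzprime_neq0 prP).
exists (maxn y m.+1) => Q; rewrite inE => /orP[/eqP->|/sy/mem_primes_between[prQ [n nz lpn]]].
  by apply/mem_primes_between; split=> //; exists m; rewrite // leq_max ltnSn orbT.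
by apply/mem_primes_between; split=> //; exists n; rewrite // leq_max; lia.
Qed.

Variables (R : realType) (k : nat).
Hypothesis k_ge2 : (2 <= k)%N.

Definition pow_density P : R := (ideal_norm P ^ k)%:R^-1.

Lemma pow_densityE P : pow_density P = (ideal_norm P ^ k)%:R^-1.
Proof. by []. Qed.

Lemma pow_density_ge0 P : 0 <= pow_density P.
Proof. by rewrite invr_ge0. Qed.

Lemma pow_density_le P m : nzprime P -> least_pos P m ->
  pow_density P <= m%:R^-2.
Proof.
move=> prP lp; have m1 := least_pos_prime_gt1 prP lp.
have := least_pos_norm (nzprime_neq0 prP) lp => mN.
rewrite /pow_density -natrX lef_pV2 ?posrE ?ltr0n ?expn_gt0 ?(ltnW m1) ?(leq_trans (ltnW m1) mN) //.
rewrite ler_nat; apply: leq_trans (leq_pexp2l (ltnW m1) k_ge2) _.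
by rewrite leq_exp2r // (leq_trans _ k_ge2).
Qed.

Lemma pow_density_le_half P : nzprime P -> pow_density P <= 1 / 2.
Proof.
move=> prP; have [m lp] := least_pos_exists (nzprime_neq0 prP).
have m1 := least_pos_prime_gt1 prP lp; apply: le_trans (pow_density_le prP lp) _.
rewrite div1r lef_pV2 ?posrE ?exprn_gt0 ?ltr0n ?(ltnW m1) //.
by rewrite -natrX ler_nat; nia.
Qed.

Lemma sum_pow_density_at m : (0 < m)%N ->
  \sum_(P <- primes_at m) pow_density P <= d%:R * m%:R^-2.
Proof.
move=> m0; apply: (@le_trans _ _ (\sum_(P <- primes_at m) m%:R^-2)).
  rewrite big_seq [leRHS]big_seq; apply: ler_sum => P /mem_primes_at[prP lp].
  exact: pow_density_le.
rewrite big_const_seq count_predT iter_addr_0 -[leLHS]mulr_natl ler_wpM2r //.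
by rewrite ler_nat; apply: primes_at_card.
Qed.

(** At most d primes have least positive integer m, and each contributes at
    most 1/m^2 <= 1/(m - 1) - 1/m, which telescopes. *)
Lemma sum_pow_density_between y z : (0 < y)%N ->
  \sum_(P <- primes_between y.+1 z) pow_density P <= d%:R / y%:R.
Proof.
move=> y0; rewrite /primes_between big_flatten /= big_map.
suff h n : \sum_(y.+1 <= m < y.+1 + n) \sum_(P <- primes_at m) pow_density P
    <= d%:R / y%:R - d%:R / (y + n)%:R.
  have [yz|zy] := leqP y.+1 z.
    by have := h (z - y.+1)%N; rewrite subnKC //; move=> /le_trans; apply; rewrite gerBl divr_ge0.
  by rewrite big_geq ?divr_ge0 // ltnW.
elim: n => [|n IHn]; first by rewrite addn0 big_geq ?addn0 ?subrr.
rewrite addnS big_nat_recr /=; last by rewrite leq_addr.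
apply: le_trans (lerD IHn (@sum_pow_density_at (y.+1 + n) _)) _ => //.
rewrite addSn addnS -natr1; set x : R := (y + n)%:R.
have x0 : 0 < x by rewrite ltr0n addn_gt0 y0.
suff key : (x + 1)^-2 <= x^-1 - (x + 1)^-1.
  rewrite -addrA lerD2l -!mulrN -mulrDr ler_wpM2l //.
  by move: key; move: ((x + 1)^-2) (x^-1) ((x + 1)^-1) => u v w; lra.
rewrite -subr_ge0.
have -> : x^-1 - (x + 1)^-1 - (x + 1)^-2 = (x * (x + 1) ^+ 2)^-1.
  by field; rewrite -natrD -/x !gt_eqF // addr_gt0.
by rewrite invr_ge0 mulr_ge0 ?sqr_ge0 // ltW.
Qed.

End Primes.
Arguments primes_at {K} m.
Arguments primes_between {K} y z.
Arguments primes_below {K} y.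

(** * The Euler product *)

Lemma cvg_prod_seq (R : realType) (T : eqType) (s : seq T) (u : T -> nat -> R) (l : T -> R) :
  (forall i, i \in s -> u i n @[n --> \oo] --> l i) ->
  \prod_(i <- s) u i n @[n --> \oo] --> \prod_(i <- s) l i.
Proof.
elim: s => [|i s IHs] us.
  by under eq_fun do rewrite big_nil; rewrite big_nil; exact: cvg_cst.
under eq_fun do rewrite big_cons; rewrite big_cons; apply: cvgM.
  by apply: us; rewrite mem_head.
by apply: IHs => j js; apply: us; rewrite inE js orbT.
Qed.

Section EulerProduct.
Variables (K : fieldExtType rat) (d : nat).
Local Notation OK := (ringOfIntegers K).
Variable iota : {additive 'rV[int]_d -> OK}.
Hypothesis iota_bij : bijective iota.
Implicit Types (I J P Q X : ideal OK) (s T : seq (ideal OK)).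
Variables (R : realType) (k : nat).
Hypothesis k_ge2 : (2 <= k)%N.

Let dom := @OK_domain K.
Let fin := OK_finite_index iota_bij.
Let nor := fun I a b => @OK_normal K I a b fin.
Local Notation pow_density := (pow_density R k).

Definition nzprimes T := forall P, P \in T -> nzprime P.

Lemma nzprimes_cons P T : nzprimes (P :: T) -> nzprime P /\ nzprimes T.
Proof. by move=> prT; split=> [|Q QT]; apply: prT; rewrite inE ?eqxx ?QT ?orbT. Qed.

(** Truncating the exponents makes both sides of the Euler product finite. *)
Definition smooth n T : seq (ideal OK) :=
  foldr (fun P L => [seq P ^+ e * X | e <- index_iota 0 n, X <- L]) [:: 1] T.

Lemma smooth_cons n P T X : X \in smooth n (P :: T) <->
  exists e Y, [/\ (e < n)%N, Y \in smooth n T & X = P ^+ e * Y].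
Proof.
split=> [/allpairsP[[e Y] /= [+ YT ->]]|[e [Y [en YT ->]]]].
  by rewrite mem_index_iota => en; exists e, Y.
by apply/allpairsP; exists (e, Y); split; rewrite //= mem_index_iota.
Qed.

Lemma smooth_neq0 n T X : nzprimes T -> X \in smooth n T -> X <> 0.
Proof.
elim: T X => [|P T IHT] X.
  by rewrite inE => _ /eqP-> e; have /eqP := oner_neq0 OK; apply; apply: ideal0E; rewrite -e.
move=> /nzprimes_cons[prP prT] /smooth_cons[e [Y [_ YT ->]]].
apply: (ideal_mul_neq0 dom); last exact: IHT YT.
exact: (ideal_exp_neq0 dom (nzprime_neq0 prP)).
Qed.

Lemma smooth_prime_dvd n T X Q : nzprimes T -> nzprime Q -> X \in smooth n T ->
  X `<=` Q -> Q \in T.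
Proof.
move=> + prQ; elim: T X => [|P T IHT] X.
  by rewrite inE => _ /eqP-> /(_ 1 (ideal1E _))/(nzprime1 prQ).
move=> /nzprimes_cons[prP prT] /smooth_cons[e [Y [_ YT ->]]].
move=> /(nzprime_mul_sub prQ)[|/(IHT _ prT YT)]; last by rewrite inE => ->; rewrite orbT.
have [-> |e0] := posnP e; first by rewrite expr0 => /(_ 1 (ideal1E _))/(nzprime1 prQ).
have -> : P ^+ e = \prod_(J <- nseq e P) J by rewrite big_nseq iter_mulr_1.
move=> /(nzprime_prod_sub prQ)[J]; rewrite mem_nseq e0 => /eqP-> PQ.
by rewrite -(nzprime_sub_eq fin prP prQ PQ) mem_head.
Qed.

(** Unique factorisation: cancel the smaller power of P; if the exponents
    differed, P would divide a product of the other primes. *)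
Lemma smooth_uniq n T : nzprimes T -> uniq T -> uniq (smooth n T).
Proof.
elim: T => [|P T IHT] //= /nzprimes_cons[prP prT] /andP[PT uT].
apply: allpairs_uniq; [exact: iota_uniq|exact: IHT|].
have P0 := nzprime_neq0 prP.
have invP e : invertible (P ^+ e).
  exact/(ideal_invertible dom fin nor)/(ideal_exp_neq0 dom P0).
have lt_absurd e e' Y Y' : Y \in smooth n T -> (e < e')%N -> P ^+ e * Y <> P ^+ e' * Y'.
  move=> YT lte; rewrite -(subnKC lte) addSnnS exprD -mulrA => /(invertible_inj dom (invP e)) eY.
  case/negP: PT; apply: (smooth_prime_dvd prT prP YT) => x.
  by rewrite eY exprS -mulrA => /ideal_mulSl.
move=> [e Y] [e' Y'] /allpairsP[[e1 Y1] /= [_ Y1T [-> ->]]].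
move=> /allpairsP[[e2 Y2] /= [_ Y2T [-> ->]]] eP.
have e12 : e1 = e2.
  by case: (ltngtP e1 e2) => // /lt_absurd h; [case: (h _ _ Y1T eP)|case: (h _ _ Y2T (esym eP))].
by move: eP; rewrite e12 => /(invertible_inj dom (invP e2)) ->.
Qed.

Lemma smooth_complete n T s : nzprimes T -> uniq T -> {subset s <= T} ->
  (size s < n)%N -> \prod_(P <- s) P \in smooth n T.
Proof.
elim: T s => [|P T IHT] s prT uT sT sn.
  by case: s sT {sn} => [|Q s] h; rewrite ?big_nil ?inE //; have := h Q (mem_head _ _).
have [prP prT'] := nzprimes_cons prT; case/andP: uT => PT uT.
apply/smooth_cons; exists (count_mem P s), (\prod_(Q <- [seq Q <- s | Q != P]) Q); split.
- exact: leq_ltn_trans (count_size _ _) sn.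
- apply: IHT => // [Q|]; last first.
    by apply: leq_ltn_trans sn; rewrite size_filter count_size.
  by rewrite mem_filter => /andP[QP /sT]; rewrite inE (negPf QP).
rewrite (bigID (pred1 P)) /= big_filter; congr (_ * _).
by rewrite (eq_bigr (fun=> P)) => [|Q /eqP //]; rewrite big_const_seq iter_mulr_1.
Qed.

Lemma pow_densityM I J : I <> 0 -> J <> 0 ->
  pow_density (I * J)%R = pow_density I * pow_density J.
Proof.
move=> I0 J0; rewrite !pow_densityE (ideal_normM dom fin nor) // expnMn natrM.
by rewrite invfM.
Qed.

Lemma pow_densityX I e : I <> 0 -> pow_density (I ^+ e)%R = pow_density I ^+ e.
Proof.
move=> I0; rewrite !pow_densityE (ideal_normX dom fin nor) // exprVn -natrX.
by rewrite -!expnM mulnC.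
Qed.

Lemma pow_density1 : pow_density (1 : ideal OK) = 1.
Proof. by rewrite !pow_densityE ideal_norm1 exp1n invr1. Qed.

Lemma sum_smooth n T : nzprimes T ->
  \sum_(I <- smooth n T) pow_density I =
  \prod_(P <- T) \sum_(0 <= e < n) pow_density P ^+ e.
Proof.
elim: T => [|P T IHT]; first by rewrite big_seq1 big_nil pow_density1.
move=> /nzprimes_cons[prP prT]; rewrite big_cons -IHT //= big_allpairs_dep mulr_suml.
apply: eq_bigr => e _; rewrite mulr_sumr [LHS]big_seq [RHS]big_seq.
apply: eq_bigr => X XT; rewrite pow_densityM ?pow_densityX //.
- exact: nzprime_neq0.
- exact: (ideal_exp_neq0 dom (nzprime_neq0 prP)).
- exact: smooth_neq0 XT.
Qed.

Definition euler_factor T : R := \prod_(P <- T) (1 - pow_density P).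

Lemma euler_factor_gt0 T : nzprimes T -> 0 < euler_factor T.
Proof.
move=> prT; rewrite /euler_factor big_seq; apply: prodr_gt0 => P /prT prP.
by have := pow_density_le_half iota_bij R k_ge2 prP; lra.
Qed.

Lemma euler_factor_le1 T : nzprimes T -> euler_factor T <= 1.
Proof.
move=> prT; rewrite /euler_factor big_seq.
apply: prodr_ile1 => P /prT prP.
by have := pow_density_le_half iota_bij R k_ge2 prP; have := pow_density_ge0 R k P; lra.
Qed.

Lemma sum_smooth_cvg T : nzprimes T ->
  \sum_(I <- smooth n T) pow_density I @[n --> \oo] --> (euler_factor T)^-1.
Proof.
move=> prT; under eq_fun do rewrite sum_smooth //.
rewrite /euler_factor -prodfV; apply: cvg_prod_seq => P /prT prP.
have h := pow_density_le_half iota_bij R k_ge2 prP; have h0 := pow_density_ge0 R k P.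
have -> : (fun n => \sum_(0 <= e < n) pow_density P ^+ e) = series (geometric 1 (pow_density P)).
  by apply/funext => n; apply: eq_bigr => e _; rewrite /geometric /= mul1r.
rewrite -[_^-1]mul1r; apply: cvg_geometric_series.
by rewrite ger0_norm //; lra.
Qed.

Lemma sum_smooth_le n T : nzprimes T ->
  \sum_(I <- smooth n T) pow_density I <= (euler_factor T)^-1.
Proof.
move=> prT; rewrite -(cvg_lim _ (sum_smooth_cvg prT)) //.
apply: nondecreasing_cvgn_le; last by apply/cvg_ex; exists (euler_factor T)^-1; apply: sum_smooth_cvg.
move=> m p mp; rewrite !sum_smooth // big_seq [leRHS]big_seq; apply: ler_prod => P _.
have h0 e : 0 <= pow_density P ^+ e by rewrite exprn_ge0 // pow_density_ge0.
rewrite sumr_ge0 //= [leRHS](big_cat_nat _ mp) //= lerDl sumr_ge0 //.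
Qed.

Local Notation zeta := (dedekind_zeta K (k%:R : R)).

Lemma zeta_term I :
  ((ideal_norm I)%:R `^ (- k%:R))%:E = (pow_density I)%:E :> \bar R.
Proof. by rewrite powRN powR_mulrn // !pow_densityE natrX. Qed.

Lemma ideal_set_inj : injective (@ideal_set OK).
Proof. by move=> I J e; apply: ideal_eq => x; rewrite e. Qed.

Lemma sum_ideal_sets (L : seq (ideal OK)) : uniq L ->
  (\sum_(I \in [set` [seq ideal_set X | X <- L]]) ((ideal_norm I)%:R `^ (- (k%:R : R))%R)%:E)%E
   = (\sum_(X <- L) pow_density X)%:E :> \bar R.
Proof.
move=> uL; rewrite -fsbig_seq; last by rewrite map_inj_uniq //; exact: ideal_set_inj.
by rewrite big_map -sumEFin; apply: eq_bigr => X _; rewrite zeta_term.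
Qed.

Lemma zeta_ge T : nzprimes T -> uniq T -> ((euler_factor T)^-1%:E <= zeta)%E.
Proof.
move=> prT uT.
have le n : ((\sum_(I <- smooth n T) pow_density I)%:E <= zeta)%E.
  apply: ereal_sup_ubound; exists [set` [seq ideal_set X | X <- smooth n T]].
    split; first exact: finite_seq.
    move=> _ /mapP[X XT ->]; split; first exact: idealP.
    by move=> X0; apply: (smooth_neq0 prT XT); apply: ideal_set_inj.
  by rewrite sum_ideal_sets // smooth_uniq.
case: zeta le => [z||] le; [|by rewrite leey|by have := le 0%N].
rewrite lee_fin; apply: (closed_cvg (fun x => x <= z) (@closed_le _ z)) (sum_smooth_cvg prT).
by apply: nearW => n; rewrite -lee_fin.
Qed.

(** Finitely many ideals involve finitely many primes and bounded exponents. *)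
Lemma common_smooth (L : seq (ideal OK)) : (forall X, X \in L -> X <> 0) ->
  exists y n, {subset L <= smooth n (primes_below y)}.
Proof.
move=> L0.
suff [s [n [prs sL]]] : exists s n, nzprimes s /\ forall X, X \in L ->
    exists t, [/\ {subset t <= s}, (size t < n)%N & X = \prod_(P <- t) P].
  have [y sy] := nzprimes_below iota_bij prs; exists y, n => X /sL[t [ts tn ->]].
  apply: smooth_complete tn => [P /(primes_belowP iota_bij)//||P /ts/sy //].
  exact: (primes_between_uniq iota_bij).
elim: L L0 => [|X L IHL] L0; first by exists [::], 0%N; split.
have [s [n [prs sL]]] : exists s n, nzprimes s /\ forall X, X \in L ->
    exists t, [/\ {subset t <= s}, (size t < n)%N & X = \prod_(P <- t) P].
  by apply: IHL => Y YL; apply: L0; rewrite inE YL orbT.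
have [t prt eX] := ideal_factorization dom fin nor (L0 X (mem_head _ _)).
exists (t ++ s), (maxn (size t).+1 n); split.
  by move=> P; rewrite mem_cat => /orP[/prt|/prs].
move=> Y; rewrite inE => /orP[/eqP->|/sL[t' [t's t'n ->]]].
  by exists t; split=> // [P Pt|]; rewrite ?mem_cat ?Pt // leq_max leqnn.
by exists t'; split=> // [P /t's Ps|]; rewrite ?mem_cat ?Ps ?orbT // leq_max t'n orbT.
Qed.

Lemma zeta_le (B : R) : (forall y, (euler_factor (primes_below y))^-1 <= B) ->
  (zeta <= B%:E)%E.
Proof.
move=> leB; apply: ge_ereal_sup => _ [S [finS SZ] <-].
have idl (I : set OK) : exists J : ideal OK, is_ideal I -> I = J.
  have [h|h] := pselect (is_ideal I); first by exists (Ideal h).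
  by exists 0.
have [f fP] := choice idl.
have [X XS|y [n Sn]] := @common_smooth [seq f A | A <- fset_set S].
  case/mapP: XS => A; rewrite in_fset_set // => /set_mem/SZ[/fP eA A0] -> fA0.
  by apply: A0; rewrite eA fA0.
have prT : nzprimes (primes_below y : seq (ideal OK)) by move=> P /(primes_belowP iota_bij).
have uT := primes_between_uniq iota_bij 0 y : uniq (primes_below y : seq (ideal OK)).
apply: (@le_trans _ _ (\sum_(X <- smooth n (primes_below y)) pow_density X)%:E); last first.
  by rewrite lee_fin; apply: le_trans (leB y); apply: sum_smooth_le.
rewrite -sum_ideal_sets ?smooth_uniq //; apply: lee_fsum_nneg_subset => //; first exact: finite_seq.
move=> A /set_mem SA; apply: mem_set => /=.
have [/fP -> _] := SZ _ SA; apply: map_f; apply: Sn; apply: map_f.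
by rewrite in_fset_set //; apply: mem_set.
Qed.

Local Notation ef y := (euler_factor (primes_below y)).

Lemma ef_gt0 y : 0 < ef y. Proof. by apply: euler_factor_gt0 => P /(primes_belowP iota_bij). Qed.

Lemma inv_ef_nondecreasing : nondecreasing_seq (fun y => (ef y)^-1).
Proof.
move=> y z yz; rewrite lef_pV2 ?posrE ?ef_gt0 //.
rewrite {1}/primes_below (@primes_between_cat _ 0 y z) // /euler_factor big_cat /=.
rewrite ler_piMr //; first exact/ltW/ef_gt0.
by apply: euler_factor_le1 => P /(mem_primes_between iota_bij)[].
Qed.

(** On [0, 1/2], 1/(1 - x) <= 1 + 2x <= exp(2x), and the sum of N(P)^(-k)
    converges. *)
Lemma inv_ef_bounded : exists B : R, forall y, (ef y)^-1 <= B.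
Proof.
pose S0 : R := \sum_(P <- primes_between (K := K) 0 2) pow_density P.
exists (expR (2 * (S0 + d%:R))) => y.
apply: le_trans (inv_ef_nondecreasing (leq_addr 2 y)) _.
have prT P : P \in primes_below (y + 2) -> nzprime P by move=> /(primes_belowP iota_bij).
apply: (@le_trans _ _ (expR (2 * \sum_(P <- primes_below (K := K) (y + 2)) pow_density P))).
  rewrite mulr_sumr expR_sum /euler_factor -prodfV big_seq [leRHS]big_seq.
  apply: ler_prod => P /prT prP; have h := pow_density_le_half iota_bij R k_ge2 prP.
  have h0 := pow_density_ge0 R k P; rewrite invr_ge0; apply/andP; split; first by lra.
  apply: le_trans (expR_ge1Dx _); rewrite -div1r ler_pdivrMr; last by lra.
  nra.
rewrite ler_expR ler_pM2l // /primes_below (@primes_between_cat _ 0 2 (y + 2)) ?leq_addl //.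
rewrite big_cat lerD2l /=.
by have := sum_pow_density_between iota_bij R k_ge2 (y + 2) (ltnSn 0); rewrite divr1.
Qed.

(** By unique factorisation, the inverse of each finite product is the sum of
    N(I)^(-k) over the ideals I composed of the primes in it; these sums
    increase to zeta(k). *)
Lemma ef_cvg : ef y @[y --> \oo] --> kfree_density R K k.
Proof.
have [B leB] := inv_ef_bounded.
have cu : cvgn (fun y => (ef y)^-1).
  by apply: nondecreasing_is_cvgn; [exact: inv_ef_nondecreasing | exists B => _ [y _ <-]].
pose l := limn (fun y => (ef y)^-1).
have lel y : (ef y)^-1 <= l by apply: nondecreasing_cvgn_le => //; exact: inv_ef_nondecreasing.
have ez : zeta = l%:E.
  have hle := zeta_le lel.
  have hge y : ((ef y)^-1%:E <= zeta)%E.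
    by apply: zeta_ge; [move=> P /(primes_belowP iota_bij) | exact: (primes_between_uniq iota_bij)].
  apply/eqP; rewrite eq_le hle /=; case: zeta hge => [z||] hge; [|by rewrite leey|by have := hge 0%N].
  rewrite lee_fin; apply: limr_le => //; apply: nearW => y.
  by have := hge y; rewrite lee_fin.
have l0 : 0 < l by apply: lt_le_trans (lel 0%N); rewrite invr_gt0 ef_gt0.
rewrite /kfree_density ez /=.
have -> : (fun y => ef y) = (fun y => ((ef y)^-1)^-1) by apply/funext => y; rewrite invrK.
by apply: cvgV cu; rewrite gt_eqF.
Qed.

End EulerProduct.

(** * Variance of a finite sieve *)

Lemma sumr_fset_const (R : pzRingType) (T : choiceType) (X : {fset T}) (a : R) :
  \sum_(x <- X) a = #|` X|%:R * a.
Proof. by rewrite big_const_seq count_predT iter_addr_0 mulr_natl. Qed.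

Section FiniteSieve.
Variables (K : fieldExtType rat) (d : nat).
Local Notation OK := (ringOfIntegers K).
Variable iota : {additive 'rV[int]_d -> OK}.
Hypothesis iota_bij : bijective iota.
Implicit Types (I J : ideal OK) (S : seq (ideal OK)) (x b c : OK).
Variable R : realType.

Let fin := OK_finite_index iota_bij.
Let dom := @OK_domain K.

Definition mem_ind I x : R := (`[< I x >])%:R.
Definition inv_norm I : R := (ideal_norm I)%:R^-1.
Definition sieve S x : R := \prod_(I <- S) (1 - mem_ind I x).
Definition sieve_density S : R := \prod_(I <- S) (1 - inv_norm I).

Definition sieving S :=
  (forall I, I \in S -> I <> 0 /\ (2 <= ideal_norm I)%N) /\
  pairwise (fun I J => I + J == 1) S.

Lemma sieving_cons I S : sieving (I :: S) ->
  [/\ I <> 0, (2 <= ideal_norm I)%N, (forall J, J \in S -> I + J = 1) & sieving S].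
Proof.
move=> [nS /= /andP[/allP cI cS]]; have [I0 N2] := nS I (mem_head _ _); split=> //.
  by move=> J /cI/eqP.
by split=> // J JS; apply: nS; rewrite inE JS orbT.
Qed.

Lemma mem_ind_bounds I x : 0 <= mem_ind I x <= 1.
Proof. by rewrite /mem_ind; case: asboolP; rewrite ?ler01 ?lexx. Qed.

Lemma sieve_bounds S x : 0 <= sieve S x <= 1.
Proof.
have h I : 0 <= 1 - mem_ind I x <= 1 by have := mem_ind_bounds I x; lra.
by rewrite prodr_ge0 ?prodr_ile1 // => I _; have /andP[] := h I.
Qed.

Lemma inv_norm_bounds I : (2 <= ideal_norm I)%N -> 0 <= inv_norm I <= 1 / 2.
Proof.
move=> N2; rewrite invr_ge0 ler0n /= div1r lef_pV2 ?posrE ?ltr0n ?ler_nat //.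
exact: leq_trans N2.
Qed.

Lemma sieve_density_bounds S : sieving S -> 0 <= sieve_density S <= 1.
Proof.
move=> [nS _]; rewrite /sieve_density big_seq.
have h I : I \in S -> 0 <= 1 - inv_norm I <= 1.
  by move=> /nS[_ /inv_norm_bounds]; lra.
by rewrite prodr_ge0 ?prodr_ile1 // => I /h // /andP[].
Qed.

Lemma periodic_mem_ind I b : periodic I (fun x => mem_ind I (x + b)).
Proof. exact: periodic_mem. Qed.

Lemma sieving_finite S I : sieving S -> I \in S -> finite_index I.
Proof. by move=> [nS _] /nS[/fin]. Qed.

Lemma periodic_sieve S b : periodic (\prod_(I <- S) I) (fun x => sieve S (x + b)).
Proof.
apply: periodic_prod => I _ x y Ixy; congr (1 - _).
exact: periodic_mem_ind.
Qed.

Lemma mean_sieve S b : sieving S ->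
  mean_mod (\prod_(I <- S) I) (fun x => sieve S (x + b)) = sieve_density S.
Proof.
move=> sS; have [_ cS] := sS; have finS I := @sieving_finite S I sS.
rewrite mean_mod_prod //; last first.
  by move=> I _ x y Ixy; congr (1 - _); apply: periodic_mem_ind.
rewrite big_seq [RHS]big_seq; apply: eq_bigr => I /finS finI.
rewrite (@eq_mean_mod _ _ _ _ (fun x => 1 + (-1) * mem_ind I (x + b))); last first.
  by move=> x; rewrite mulN1r.
by rewrite mean_modD mean_modZ mean_mod1 // mean_mod_mem // mulN1r.
Qed.

(** The probability that neither x + b nor x + c lies in I, for x uniform
    modulo I, as a function of the difference b - c. *)
Definition pair_factor I c : R := 1 - 2 * inv_norm I + mem_ind I c * inv_norm I.

Lemma mean_sieve_pair S b c : sieving S ->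
  mean_mod (\prod_(I <- S) I) (fun x => sieve S (x + b) * sieve S (x + c)) =
  \prod_(I <- S) pair_factor I (b - c).
Proof.
move=> sS; have [_ cS] := sS; have finS I := @sieving_finite S I sS.
rewrite (@eq_mean_mod _ _ _ _ (fun x => \prod_(I <- S)
  ((1 - mem_ind I (x + b)) * (1 - mem_ind I (x + c))))); last first.
  by move=> x; rewrite -big_split.
rewrite mean_mod_prod //; last first.
  move=> I _ x y Ixy.
  by rewrite (periodic_mem_ind b Ixy) (periodic_mem_ind c Ixy).
rewrite big_seq [RHS]big_seq; apply: eq_bigr => I /finS finI.
rewrite (@eq_mean_mod _ _ _ _ (fun x => 1 + ((-1) * mem_ind I (x + c) +
   (mem_ind I (b - c) - 1) * mem_ind I (x + b)))); last first.
  move=> x; rewrite /mem_ind; case: asboolP => [Ib|nIb]; case: asboolP => [Ic|nIc]; rewrite /=.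
  - rewrite asboolT; first by rewrite /=; lra.
    have -> : b - c = (x + b) - (x + c) by ring.
    exact: idealB.
  - rewrite asboolF; first by rewrite /=; lra.
    move=> Ibc; apply: nIc; have -> : x + c = (x + b) - (b - c) by ring.
    exact: idealB.
  - by rewrite mulr0; lra.
  - by rewrite mulr0; lra.
rewrite !mean_modD !mean_modZ mean_mod1 // !mean_mod_mem // /pair_factor /inv_norm.
by ring.
Qed.

Definition window_error S (B : {fset OK}) x : R :=
  \sum_(b <- B) sieve S (x + b) - sieve_density S * #|` B|%:R.

Definition sieve_variance S B : R :=
  mean_mod (\prod_(I <- S) I) (fun x => window_error S B x ^+ 2).

Lemma periodic_window_error S B :
  periodic (\prod_(I <- S) I) (fun x => window_error S B x ^+ 2).
Proof.
move=> x y xy; congr ((_ - _) ^+ 2); apply: eq_bigr => b _.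
exact: periodic_sieve.
Qed.

Lemma sieve_varianceE S B : sieving S ->
  sieve_variance S B = \sum_(b <- B) \sum_(c <- B) \prod_(I <- S) pair_factor I (b - c)
    - (#|` B|%:R * sieve_density S) ^+ 2.
Proof.
move=> sS; have [_ cS] := sS; have finS I := @sieving_finite S I sS.
have [finM _] := finite_index_prod finS cS.
set D := sieve_density S; set n : R := #|` B|%:R.
rewrite /sieve_variance (@eq_mean_mod _ _ _ _ (fun x =>
  \sum_(b <- B) (\sum_(c <- B) sieve S (x + b) * sieve S (x + c)) +
  (- 2 * D * n * \sum_(b <- B) sieve S (x + b) + (D * n) ^+ 2))); last first.
  move=> x; rewrite /window_error -/D -/n.
  set s := \sum_(b <- B) sieve S (x + b).
  have -> : \sum_(b <- B) \sum_(c <- B) sieve S (x + b) * sieve S (x + c) = s * s.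
    by rewrite big_distrl /=; apply: eq_bigr => b _; rewrite -mulr_sumr.
  by ring.
rewrite !mean_modD mean_modZ mean_mod_sum mean_mod_cst // mean_mod_sum.
rewrite (eq_bigr (fun b => \sum_(c <- B) \prod_(I <- S) pair_factor I (b - c))); last first.
  by move=> b _; rewrite mean_mod_sum; apply: eq_bigr => c _; apply: mean_sieve_pair.
rewrite [X in _ + (_ * X + _)](eq_bigr (fun=> D)) => [|b _]; last exact: mean_sieve.
rewrite sumr_fset_const -/n.
by ring.
Qed.

Local Notation disc n := ((d * (2 * n).+1 ^ d.-1)%:R : R).

(** Expanding the product over I in S writes the left-hand side as an average,
    with nonnegative weights of total at most 1, of counts of pairs congruent
    modulo a product of members of S; each count is known up to #B times the
    discrepancy, and the main terms recombine. *)
Lemma pair_sum_bound S J n (B := ball iota n) : sieving S -> J <> 0 ->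
  (forall I, I \in S -> J + I = 1) ->
  `| \sum_(b <- B) \sum_(c <- B) mem_ind J (b - c) * \prod_(I <- S) pair_factor I (b - c)
     - #|` B|%:R ^+ 2 * inv_norm J * sieve_density S ^+ 2 |
  <= #|` B|%:R * disc n * sieve_density S.
Proof.
elim: S J => [|I S IHS] J.
  move=> _ J0 _; rewrite /sieve_density big_nil expr1n !mulr1.
  rewrite exchange_big /=.
  rewrite (eq_bigr (fun c => (hits iota J n c)%:R)); last first.
    move=> c _; rewrite /hits natr_sum; apply: eq_bigr => b _.
    by rewrite big_nil mulr1.
  have -> : #|` B|%:R ^+ 2 * inv_norm J = \sum_(c <- B) #|` B|%:R / (ideal_norm J)%:R.
    by rewrite sumr_fset_const expr2 mulrA.
  rewrite -sumrB; apply: le_trans (ler_norm_sum _ _ _) _.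
  apply: (@le_trans _ _ (\sum_(c <- B) disc n)).
    by apply: ler_sum => c _; apply: hits_equidistributed.
  by rewrite sumr_fset_const.
move=> /sieving_cons[I0 N2 cI sS] J0 cJ.
have JI : J + I = 1 by apply: cJ; rewrite mem_head.
have cJ' L : L \in S -> J + L = 1 by move=> LS; apply: cJ; rewrite inE LS orbT.
have JI0 : J * I <> 0 by apply: (ideal_mul_neq0 dom).
have cJI L : L \in S -> J * I + L = 1.
  by move=> LS; rewrite addrC; apply: comax_mulr; rewrite addrC; [apply: cJ' | apply: cI].
have h1 := IHS J sS J0 cJ'; have h2 := IHS _ sS JI0 cJI.
have eN : inv_norm (J * I) = inv_norm J * inv_norm I.
  have [_ e] := finite_index_comax JI (fin J0) (fin I0).
  by rewrite /inv_norm e natrM invfM.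
have hq := inv_norm_bounds N2.
have -> : sieve_density (I :: S) = (1 - inv_norm I) * sieve_density S.
  by rewrite /sieve_density big_cons.
rewrite eN in h2.
have -> : \sum_(b <- B) \sum_(c <- B)
      mem_ind J (b - c) * \prod_(L <- I :: S) pair_factor L (b - c)
  = (1 - 2 * inv_norm I) * (\sum_(b <- B) \sum_(c <- B)
      mem_ind J (b - c) * \prod_(L <- S) pair_factor L (b - c))
  + inv_norm I * (\sum_(b <- B) \sum_(c <- B)
      mem_ind (J * I) (b - c) * \prod_(L <- S) pair_factor L (b - c)).
  rewrite !mulr_sumr -big_split /=; apply: eq_bigr => b _.
  rewrite !mulr_sumr -big_split /=; apply: eq_bigr => c _.
  have -> : mem_ind (J * I) (b - c) = mem_ind J (b - c) * mem_ind I (b - c).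
    rewrite /mem_ind -natrM mulnb -asbool_and; congr (nat_of_bool _)%:R.
    exact/asbool_equiv_eq/comax_mulE.
  by rewrite big_cons /pair_factor; ring.
move: h1 h2; rewrite !ler_norml.
set s1 := \sum_(b <- B) _; set s2 := \sum_(b <- B) _.
set q := inv_norm I in hq *; set r := sieve_density S; set w := #|` B|%:R ^+ 2 * _.
set e := #|` B|%:R * disc n.
have -> : #|` B|%:R ^+ 2 * (inv_norm J * q) = w * q by rewrite /w mulrA.
move=> /andP[h1 h1'] /andP[h2 h2']; case/andP: hq => q0 q1.
have q2 : 0 <= 1 - 2 * q by lra.
have := ler_wpM2l q2 h1; have := ler_wpM2l q2 h1'.
have := ler_wpM2l q0 h2; have := ler_wpM2l q0 h2'.
by move=> *; apply/andP; split; nra.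
Qed.

Lemma mem_ind1 c : mem_ind (1 : ideal OK) c = 1.
Proof. by rewrite /mem_ind asboolT. Qed.

Lemma sieve_variance_le S n : sieving S ->
  sieve_variance S (ball iota n) <= #|` ball iota n|%:R * disc n.
Proof.
move=> sS; have := @pair_sum_bound S 1 n sS.
rewrite /inv_norm ideal_norm1 invr1 mulr1 -exprMn.
rewrite sieve_varianceE // => h.
have n10 : (1 : ideal OK) <> 0.
  by move=> e; have /eqP := oner_neq0 OK; apply; apply: ideal0E; rewrite -e.
have c1 I : I \in S -> 1 + I = 1 by move=> _; apply: ideal_eq1; apply: ideal_addSl.
have /andP[D0 D1] := sieve_density_bounds sS.
have e0 : 0 <= #|` ball iota n|%:R * disc n by rewrite mulr_ge0.
apply: le_trans (ler_piMr e0 D1); apply: le_trans (h n10 c1).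
apply: le_trans (ler_norm _); rewrite lerD2r; apply: ler_sum => b _; apply: ler_sum => c _.
by rewrite mem_ind1 mul1r.
Qed.

End FiniteSieve.

(** * Averages over large balls *)

Section Averages.
Variables (K : fieldExtType rat) (d : nat).
Local Notation OK := (ringOfIntegers K).
Variable iota : {additive 'rV[int]_d -> OK}.
Hypothesis iota_bij : bijective iota.
Implicit Types (I J P : ideal OK) (x b : OK).
Variable R : realType.

Let dom := @OK_domain K.
Let fin := OK_finite_index iota_bij.
Let nor := fun I a b => @OK_normal K I a b fin.
Local Notation ball := (ball iota).
Local Notation disc n := ((d * (2 * n).+1 ^ d.-1)%:R : R).

Lemma pow_le_ball n : n%:R ^+ d <= (d ^ d)%:R * #|` ball n|%:R :> R.
Proof. by rewrite -natrX -natrM ler_nat; apply: ball_card_ge. Qed.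

Lemma discrepancy_small : exists E : R, 0 <= E /\
  forall n, (0 < n)%N -> disc n <= E / n%:R * #|` ball n|%:R.
Proof.
have d0 := rank_gt0 iota_bij.
exists (d * 3 ^ d.-1 * d ^ d)%:R; split=> // n n0.
have n0R : 0 < n%:R :> R by rewrite ltr0n.
rewrite mulrAC ler_pdivlMr // -!natrM ler_nat.
have le3 : ((2 * n).+1 ^ d.-1 <= 3 ^ d.-1 * n ^ d.-1)%N.
  by rewrite -expnMn; case: (d.-1) => // e; rewrite leq_exp2r //; lia.
have := ball_card_ge iota_bij n; rewrite -{1}(prednK d0) expnS => leB.
rewrite -!mulnA leq_mul2l; apply/orP; right.
apply: leq_trans (leq_mul le3 (leqnn n)) _; rewrite -mulnA leq_mul2l; apply/orP; right.
by rewrite mulnC.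
Qed.

(** Sort the points of the ball by residue class; each class receives its share
    up to the discrepancy. *)
Lemma mean_error I g n : I <> 0 -> periodic I g ->
  `| #|` ball n|%:R^-1 * \sum_(x <- ball n) g x - mean_mod I g |
  <= #|` ball n|%:R^-1 * disc n * \sum_(t < ideal_norm I) `|g (residue_rep I t)| :> R.
Proof.
move=> I0 gI; have finI := fin I0.
have [cover inj] := residue_repP finI.
have B0 : 0 < #|` ball n|%:R :> R by rewrite ltr0n ball_card_gt0.
have -> : \sum_(x <- ball n) g x =
    \sum_(t < ideal_norm I) g (residue_rep I t) * (hits iota I n (residue_rep I t))%:R.
  rewrite /hits; under [RHS]eq_bigr do rewrite natr_sum mulr_sumr.
  rewrite exchange_big /=; apply: eq_bigr => x _.
  have [t It] := cover x; rewrite (bigD1 t) //= big1 => [|u ut].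
    by rewrite asboolT // mulr1 addr0; apply: gI.
  rewrite asboolF ?mulr0 // => Iu; case/negP: ut; apply/eqP; apply: inj.
  exact: idealBtrans (idealBC Iu) It.
have -> : mean_mod I g = #|` ball n|%:R^-1 *
    \sum_(t < ideal_norm I) g (residue_rep I t) * (#|` ball n|%:R / (ideal_norm I)%:R).
  rewrite -mulr_suml /mean_mod; set s := \sum_(_ < _) _.
  have N0 : 0 < (ideal_norm I)%:R :> R by rewrite ltr0n ideal_norm_gt0.
  by field; rewrite !gt_eqF.
rewrite -mulrBr -sumrB normrM ger0_norm ?invr_ge0 // -mulrA ler_wpM2l ?invr_ge0 //.
apply: le_trans (ler_norm_sum _ _ _) _; rewrite mulr_sumr; apply: ler_sum => t _.
by rewrite -mulrBr normrM mulrC ler_wpM2r //; apply: hits_equidistributed.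
Qed.

Lemma inv_nat_lt (e c : R) : 0 < e -> \forall n \near \oo, c / n%:R < e.
Proof.
move=> e0; near=> n.
have n0 : 0 < n%:R :> R by rewrite ltr0n; near: n; exists 1%N.
rewrite ltr_pdivrMr // mulrC -ltr_pdivrMr //.
by near: n; exact: nbhs_infty_gtr.
Unshelve. all: by end_near. Qed.

Lemma mean_cvg I g : I <> 0 -> periodic I g ->
  #|` ball n|%:R^-1 * \sum_(x <- ball n) g x @[n --> \oo] --> (mean_mod I g : R).
Proof.
move=> I0 gI; apply/cvgrPdist_le => e e0.
have [E [E0 hE]] := discrepancy_small.
set G := \sum_(t < ideal_norm I) `|g (residue_rep I t)|.
have G0 : 0 <= G by apply: sumr_ge0.
near=> n; rewrite distrC; apply: le_trans (mean_error n I0 gI) _; rewrite -/G.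
have n0 : (0 < n)%N by near: n; exists 1%N.
have B0 : 0 < #|` ball n|%:R :> R by rewrite ltr0n ball_card_gt0.
apply: (@le_trans _ _ (E / n%:R * G)).
  by rewrite ler_wpM2r // mulrC ler_pdivrMr //; apply: hE.
rewrite mulrAC; apply: ltW; near: n; exact: inv_nat_lt.
Unshelve. all: by end_near. Qed.

(** * The k-free indicator and its sieve approximations *)

Variable k : nat.
Hypothesis k_ge2 : (2 <= k)%N.
Local Notation f := (kfree_mu R k).

Lemma nzprime_set (P : set OK) : is_prime_ideal P -> P <> [set 0] ->
  exists2 Q : ideal OK, nzprime Q & P = Q.
Proof.
move=> prP P0; have [[/set_mem P00 _ PD] _] := prP.
have PDM a u v : P u -> P v -> P (a * u + v).
  by move=> Pu Pv; apply/set_mem/PD; apply: mem_set.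
have idP : is_ideal P.
  split=> // [x y Px Py|a x Px]; first by rewrite -[x]mul1r; apply: PDM.
  by rewrite -[_ * _]addr0; apply: PDM.
exists (Ideal idP) => //; split=> // e; apply: P0.
by rewrite -[P]/(ideal_set (Ideal idP)) e.
Qed.

Lemma kfree_muE x : f x = (`[< forall P, nzprime P -> ~ (P ^+ k)%R x >])%:R.
Proof.
congr (nat_of_bool _)%:R; apply: asbool_equiv_eq; split.
  move=> h P [prP P0] Px; apply: (h P prP) => [e|].
    by apply: P0; apply: ideal_eq => y; rewrite e.
  by rewrite ideal_powE; apply/(@pidealS OK (P ^+ k) x).
move=> h P prP P0; have [Q prQ ->] := nzprime_set prP P0.
by rewrite ideal_powE => /(@pidealS OK (Q ^+ k) x); apply: h.
Qed.

Definition kth_powers (T : seq (ideal OK)) := [seq P ^+ k | P <- T].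

Lemma kth_powers_sieving T : nzprimes T -> uniq T -> sieving (kth_powers T).
Proof.
move=> prT uT; split=> [_ /mapP[P PT ->]|].
  have P0 := nzprime_neq0 (prT _ PT); split; first exact: (ideal_exp_neq0 dom).
  rewrite (ideal_normX dom fin nor) //.
  have [m lp] := least_pos_exists P0.
  have m1 := least_pos_prime_gt1 (prT _ PT) lp.
  have := leq_trans m1 (least_pos_norm iota_bij P0 lp) => N2.
  by have := leq_pexp2l (ltnW N2) (ltnW k_ge2); rewrite expn1; apply: leq_trans.
rewrite /kth_powers pairwise_map; have := nzprimes_pairwise_comax iota_bij prT uT.
by apply: sub_pairwise => P Q /eqP e /=; apply/eqP; apply: comax_pow.
Qed.

Lemma kth_powers_density T : nzprimes T ->
  sieve_density R (kth_powers T) = euler_factor R k T.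
Proof.
move=> prT; rewrite /sieve_density big_map /euler_factor big_seq [RHS]big_seq.
apply: eq_bigr => P /prT/nzprime_neq0 P0.
by rewrite /inv_norm (ideal_normX dom fin nor).
Qed.

Definition sieve_below y := kth_powers (primes_below y.+1).

Lemma sieve_below_sieving y : sieving (sieve_below y).
Proof.
by apply: kth_powers_sieving; [move=> P /(primes_belowP iota_bij) | exact: (primes_between_uniq iota_bij)].
Qed.

(** The indicator of the elements without factor P^k for P small, minus that of
    the k-free elements: nonzero only on the union of the P^k with P large. *)
Definition sieve_excess y x : R := sieve R (sieve_below y) x - f x.

Lemma sieve_eq1 S x : (forall I, I \in S -> ~ I x) -> sieve R S x = 1.
Proof.
move=> h; rewrite /sieve big_seq big1 // => I /h nIx.
by rewrite /mem_ind asboolF // subr0.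
Qed.

Lemma sieve_eq0 S I x : I \in S -> I x -> sieve R S x = 0.
Proof.
by move=> IS Ix; rewrite /sieve (big_rem _ IS) /= /mem_ind asboolT //= subrr mul0r.
Qed.

Lemma kfree_bounds x : 0 <= f x <= 1.
Proof. by rewrite kfree_muE; case: asboolP; rewrite ?ler01 ?lexx. Qed.

Lemma sieve_excess_bounds y x : 0 <= sieve_excess y x <= 1.
Proof.
have /andP[s0 s1] := sieve_bounds R (sieve_below y) x.
rewrite /sieve_excess kfree_muE; case: asboolP => [h|_]; last by rewrite subr0 s0.
rewrite sieve_eq1 ?subrr ?lexx ?ler01 // => _ /mapP[P /(primes_belowP iota_bij) prP ->].
exact: h.
Qed.

Lemma sieve_excess_le y x (z : nat) :
  (forall P m, nzprime P -> least_pos P m -> (P ^+ k)%R x -> (m < z)%N) ->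
  sieve_excess y x <= \sum_(P <- primes_between y.+1 z) mem_ind R (P ^+ k) x.
Proof.
move=> hz; have s0 : 0 <= \sum_(P <- primes_between y.+1 z) mem_ind R (P ^+ k) x.
  by apply: sumr_ge0 => P _; have /andP[] := mem_ind_bounds R (P ^+ k) x.
have /andP[e0 e1] := sieve_excess_bounds y x.
have [[P [prP Px]]|none] := pselect (exists P, nzprime P /\ (P ^+ k)%R x); last first.
  rewrite /sieve_excess kfree_muE asboolT; last by move=> P prP Px; apply: none; exists P.
  have /andP[_ s1] := sieve_bounds R (sieve_below y) x.
  by apply: le_trans s0; rewrite subr_le0.
have [m lp] := least_pos_exists (nzprime_neq0 prP); have mz := hz P m prP lp Px.
have [my|ym] := leqP m y.
  rewrite /sieve_excess (@sieve_eq0 _ (P ^+ k)) //.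
    by apply: le_trans s0; have := kfree_bounds x; lra.
  apply: map_f; apply/(mem_primes_between iota_bij); split=> //.
  by exists m; rewrite // ltnS.
apply: le_trans e1 _; rewrite (big_rem P) /=; last first.
  by apply/(mem_primes_between iota_bij); split=> //; exists m; rewrite // ym.
rewrite {1}/mem_ind asboolT // lerDl; apply: sumr_ge0 => Q _.
by have /andP[] := mem_ind_bounds R (Q ^+ k) x.
Qed.

(** Elements divisible by the k-th power of a large prime are rare in every
    ball, uniformly in its radius; the origin accounts for the extra 1. *)
Lemma sieve_excess_sum : exists C : nat, forall y n, (0 < y)%N ->
  \sum_(x <- ball n) sieve_excess y x <= 1 + C%:R * n%:R ^+ d * (d%:R / y%:R).
Proof.
have [C hC] := ideal_ball_sparse iota_bij; exists C => y n y0.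
have P0 P : nzprime P -> P ^+ k <> 0 by move=> /nzprime_neq0; apply: (ideal_exp_neq0 dom).
(* By the sparseness bound itself, P^k contains no nonzero point of the ball
   once the least positive integer of P reaches z. *)
pose z := (C * n ^ d).+1.
have b0 : 0 \in ball n by rewrite mem_ball // nrm0.
rewrite (big_rem 0) //= ; apply: lerD; first by have /andP[] := sieve_excess_bounds y 0.
have rem_in x : x \in rem 0 (ball n : seq OK) -> x \in ball n /\ x <> 0.
  rewrite mem_rem_uniq ?fset_uniq // inE => /andP[/eqP x0 xb]; split=> //.
apply: (@le_trans _ _ (\sum_(x <- rem 0 (ball n : seq OK))
    \sum_(P <- primes_between y.+1 z) mem_ind R (P ^+ k) x)).
  rewrite big_seq [leRHS]big_seq; apply: ler_sum => x /rem_in[xb x0].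
  apply: sieve_excess_le => P m prP lp Px; rewrite /z ltnS.
  apply: leq_trans (hC (P ^+ k) n (P0 _ prP)).
  apply: leq_trans (least_pos_norm iota_bij (nzprime_neq0 prP) lp) _.
  rewrite (ideal_normX dom fin nor); last exact: nzprime_neq0.
  rewrite -[X in (X <= _)%N]muln1; apply: leq_mul.
    have N0 : (0 < ideal_norm P)%N by apply/ideal_norm_gt0/fin/nzprime_neq0.
    by have := leq_pexp2l N0 (ltnW k_ge2); rewrite expn1.
  by rewrite (big_rem x) //= asboolT.
rewrite exchange_big /=.
apply: (@le_trans _ _ (\sum_(P <- primes_between y.+1 z) C%:R * n%:R ^+ d * pow_density R k P)).
  rewrite big_seq [leRHS]big_seq; apply: ler_sum => P /(mem_primes_between iota_bij)[prP _].
  have N0 : 0 < (ideal_norm P ^ k)%:R :> R.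
    by rewrite ltr0n expn_gt0 ideal_norm_gt0 //; apply/fin/nzprime_neq0.
  rewrite /pow_density ler_pdivlMr // mulrC.
  have := hC (P ^+ k) n (P0 _ prP); rewrite (ideal_normX dom fin nor); last exact: nzprime_neq0.
  rewrite -(ler_nat R) !natrM !natrX; apply: le_trans.
  rewrite -natrX ler_wpM2l // natr_sum [leRHS](big_rem 0) //=.
  rewrite [X in _ <= (nat_of_bool X)%:R + _]asboolF ?add0r; last by case.
  rewrite big_seq [leRHS]big_seq; apply: ler_sum => x /rem_in[xb x0].
  by rewrite /mem_ind; case: asboolP => [Px|]; rewrite ?ler0n // asboolT.
rewrite -mulr_sumr ler_wpM2l ?mulr_ge0 ?exprn_ge0 //.
exact: (sum_pow_density_between iota_bij R k_ge2 _ y0).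
Qed.

End Averages.
Arguments sieve_below {K} k y.

(** * The variance of the k-free elements *)

Lemma ler_sum_subseq (R : numDomainType) (T : eqType) (s t : seq T) (F : T -> R) :
  uniq s -> {subset s <= t} -> (forall x, 0 <= F x) ->
  \sum_(x <- s) F x <= \sum_(x <- t) F x.
Proof.
move=> us st F0; elim: s t us st => [|x s IHs] t /=.
  by move=> _ _; rewrite big_nil sumr_ge0.
move=> /andP[xs us] st; have xt : x \in t by apply: st; rewrite mem_head.
rewrite big_cons (big_rem x xt) /= lerD2l; apply: IHs => // y ys.
have : y \in t by apply: st; rewrite inE ys orbT.
rewrite (perm_mem (perm_to_rem xt)) inE => /orP[/eqP yx|//].
by rewrite -yx ys in xs.
Qed.

Section KFreeVariance.
Variables (K : fieldExtType rat) (d : nat).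
Local Notation OK := (ringOfIntegers K).
Variable iota : {additive 'rV[int]_d -> OK}.
Hypothesis iota_bij : bijective iota.
Implicit Types (x b m : OK).
Variables (R : realType) (k : nat).
Hypothesis k_ge2 : (2 <= k)%N.

Local Notation ball := (ball iota).
Local Notation f := (kfree_mu R k).
Local Notation rho := (kfree_density R K k).
Local Notation ef y := (euler_factor R k (primes_below (K := K) y)).
Let S y := sieve_below (K := K) k y.
Let S_sieving y : sieving (S y) := sieve_below_sieving iota_bij k_ge2 y.

Lemma sieve_below_density y : sieve_density R (S y) = ef y.+1.
Proof.
by apply: (kth_powers_density iota_bij) => P /(primes_belowP iota_bij).
Qed.

Lemma density_bounds : 0 <= rho <= 1.
Proof.
have ef01 y : 0 <= ef y <= 1.
  have prT : nzprimes (primes_below (K := K) y) by move=> P /(primes_belowP iota_bij).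
  by rewrite (euler_factor_le1 iota_bij) // ltW // (euler_factor_gt0 iota_bij).
have cef := @ef_cvg K d iota iota_bij R k k_ge2.
rewrite -(cvg_lim _ cef) //; have cv : cvgn (fun y => ef y) by apply/cvg_ex; exists rho.
rewrite limr_ge //=; last by apply: nearW => y; have /andP[] := ef01 y.
by apply: limr_le => //; apply: nearW => y; have /andP[] := ef01 y.
Qed.

Definition kfree_error (B : {fset OK}) m : R := \sum_(b <- B) f (m + b) - rho * #|` B|%:R.

Definition kfree_mean_square B n : R :=
  #|` ball n|%:R^-1 * \sum_(m <- ball n) kfree_error B m ^+ 2.

Definition sieve_mean_square y B n : R :=
  #|` ball n|%:R^-1 * \sum_(m <- ball n) window_error R (S y) B m ^+ 2.

Lemma window_error_norm (B : {fset OK}) (g : OK -> R) (r : R) m :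
  (forall x, 0 <= g x <= 1) -> 0 <= r <= 1 ->
  `|\sum_(b <- B) g (m + b) - r * #|` B|%:R| <= #|` B|%:R.
Proof.
move=> g01 /andP[r0 r1].
have s0 : 0 <= \sum_(b <- B) g (m + b) by apply: sumr_ge0 => b _; have /andP[] := g01 (m + b).
have s1 : \sum_(b <- B) g (m + b) <= #|` B|%:R.
  rewrite -[leRHS]mulr1 -sumr_fset_const; apply: ler_sum => b _.
  by have /andP[] := g01 (m + b).
have n0 : 0 <= #|` B|%:R :> R by [].
have h0 : 0 <= r * #|` B|%:R by rewrite mulr_ge0.
have h1 : r * #|` B|%:R <= #|` B|%:R by rewrite ler_piMl.
by rewrite ler_norml; apply/andP; split; lra.
Qed.

(** Both errors are at most #B in absolute value, so the difference of their
    squares is controlled by their difference. *)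
Lemma sqr_error_diff (B : {fset OK}) y m :
  `|kfree_error B m ^+ 2 - window_error R (S y) B m ^+ 2| <=
  2 * #|` B|%:R * (\sum_(b <- B) sieve_excess R k y (m + b) + #|` B|%:R * `|rho - ef y.+1|).
Proof.
have hX := window_error_norm B m (kfree_bounds R k) density_bounds.
have hY := window_error_norm B m (sieve_bounds R (S y)) (sieve_density_bounds R (S_sieving y)).
rewrite /kfree_error /window_error; set X := _ - rho * _ in hX *; set Y := _ - _ * _ in hY *.
have -> : X ^+ 2 - Y ^+ 2 = (X + Y) * (X - Y) by ring.
rewrite normrM; apply: ler_pM => //.
  by apply: le_trans (ler_normD _ _) _; lra.
have -> : X - Y = - \sum_(b <- B) sieve_excess R k y (m + b) - #|` B|%:R * (rho - ef y.+1).
  rewrite /X /Y sieve_below_density /sieve_excess sumrB -/(S y); ring.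
apply: le_trans (ler_normB _ _) _; rewrite normrN normrM.
rewrite (ger0_norm (ler0n R #|` B|)) lerD2r ger0_norm //.
by apply: sumr_ge0 => b _; have /andP[] := sieve_excess_bounds iota_bij R k y (m + b).
Qed.

(** The translates by B of a ball of radius n stay in the ball of radius 2 n, so
    the sieve excess contributes at most #B times its sum over that ball. *)
Lemma mean_square_diff (B : {fset OK}) N : {subset B <= ball N} ->
  exists c1 c2 c3 : R, forall y n, (0 < y)%N -> (N <= n)%N -> (0 < n)%N ->
  `|kfree_mean_square B n - sieve_mean_square y B n| <=
    c1 / n%:R + c2 / y%:R + c3 * `|rho - ef y.+1|.
Proof.
move=> BN; have [C hC] := sieve_excess_sum iota_bij R k_ge2.
set w : R := #|` B|%:R; set D : R := (d ^ d)%:R.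
exists (2 * w * w * D), (2 * w * w * (C%:R * (2 ^ d)%:R * D * d%:R)), (2 * w * w).
move=> y n y0 Nn n0; set e := `|rho - _|.
have w0 : 0 <= w by [].
have e0 z x : 0 <= sieve_excess R k z x by have /andP[] := sieve_excess_bounds iota_bij R k z x.
have B0 : 0 < #|` ball n|%:R :> R by rewrite ltr0n ball_card_gt0.
rewrite /kfree_mean_square /sieve_mean_square -mulrBr -sumrB normrM ger0_norm ?invr_ge0 //.
rewrite mulrC ler_pdivrMr //; apply: le_trans (ler_norm_sum _ _ _) _.
apply: le_trans (ler_sum _ (fun m _ => sqr_error_diff B y m)) _.
rewrite -mulr_sumr big_split /= sumr_fset_const -/e exchange_big /=.
have shift b : b \in B -> \sum_(m <- ball n) sieve_excess R k y (m + b)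
    <= 1 + C%:R * (2 ^ d)%:R * n%:R ^+ d * (d%:R / y%:R).
  (* m + b stays in the ball of radius n + N, and N <= n. *)
  move=> bB; apply: (@le_trans _ _ (\sum_(x <- ball (2 * n)) sieve_excess R k y x)).
    rewrite -(big_map (fun m => m + b) xpredT (sieve_excess R k y)).
    apply: ler_sum_subseq => // [|_ /mapP[m mn ->]].
      by rewrite map_inj_uniq ?fset_uniq //; exact: addIr.
    move: mn (BN _ bB); rewrite !mem_ball // => mn bN.
    by apply: leq_trans (nrmD iota_bij _ _) _; lia.
  apply: le_trans (hC y (2 * n)%N y0) _; rewrite lerD2l natrM exprMn natrX.
  by rewrite !mulrA.
have sum_shift : \sum_(b <- B) \sum_(m <- ball n) sieve_excess R k y (m + b)
    <= w * (1 + C%:R * (2 ^ d)%:R * n%:R ^+ d * (d%:R / y%:R)).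
  by rewrite -sumr_fset_const big_seq [leRHS]big_seq; apply: ler_sum => b /shift.
have d0 := rank_gt0 iota_bij.
have n0R : 0 < n%:R :> R by rewrite ltr0n.
have leB : n%:R ^+ d <= D * #|` ball n|%:R :> R by apply: pow_le_ball.
have le1 : 1 <= D / n%:R * #|` ball n|%:R.
  rewrite mulrAC ler_pdivlMr // mul1r; apply: le_trans leB.
  by rewrite -natrX ler_nat -{1}[n]expn1 leq_pexp2l.
set b := #|` ball n|%:R in B0 leB le1 *.
have cy0 : 0 <= C%:R * (2 ^ d)%:R * (d%:R / y%:R) :> R by rewrite !mulr_ge0 ?invr_ge0.
have := ler_wpM2l cy0 leB => leB'.
have h : w * (1 + C%:R * (2 ^ d)%:R * n%:R ^+ d * (d%:R / y%:R)) <=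
    w * (D / n%:R * b + C%:R * (2 ^ d)%:R * (d%:R / y%:R) * (D * b)).
  rewrite ler_wpM2l // lerD //; apply: le_trans leB'; rewrite mulrAC //.
have := le_trans sum_shift h => /(lerD)/(_ (lexx (b * (w * e)))) h'.
apply: le_trans (ler_wpM2l _ h') _; first by rewrite mulr_ge0.
rewrite le_eqVlt; apply/orP; left; apply/eqP; field.
by rewrite !gt_eqF // ltr0n.
Qed.

(** The error of the finite sieve is periodic, so its mean square over large
    balls tends to its variance; the k-free error differs from it by the sieve
    excess, which is sparse, and by the gap between the densities. *)
Lemma mean_square_approx (B : {fset OK}) N : {subset B <= ball N} ->
  forall e : R, 0 < e -> exists y, \forall n \near \oo,
  `|kfree_mean_square B n - sieve_variance R (S y) B| <= e.
Proof.
move=> /mean_square_diff[c1 [c2 [c3 hc]]] e e0.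
have e4 : 0 < e / 4 by lra.
have cef : `|rho - ef y.+1| @[y --> \oo] --> (0 : R).
  have := @ef_cvg K d iota iota_bij R k k_ge2; rewrite -(cvg_shiftS (fun y => ef y)) => cef.
  rewrite -(normr0 R) -(subrr rho); apply: cvg_norm; apply: cvgB => //; exact: cvg_cst.
have cef3 : c3 * `|rho - ef y.+1| @[y --> \oo] --> (0 : R).
  by rewrite -(mulr0 c3); apply: cvgMr.
have [y [y0 hy2 hy3]] : exists y, [/\ (0 < y)%N, c2 / y%:R < e / 4 & c3 * `|rho - ef y.+1| <= e / 4].
  near \oo => y; exists y; split; near: y.
  - by exists 1%N.
  - exact: inv_nat_lt.
  - exact: (cvgr_le _ cef3 _ e4).
have finM : \prod_(I <- S y) I <> 0.
  apply: (ideal_prod_neq0 (@OK_domain K)) => I IS.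
  by have [+ _] := S_sieving y => /(_ _ IS)[].
have cV : sieve_mean_square y B n @[n --> \oo] --> sieve_variance R (S y) B.
  exact: (mean_cvg iota_bij finM (@periodic_window_error K R (S y) B)).
have {}cV : \forall n \near \oo, `|sieve_variance R (S y) B - sieve_mean_square y B n| <= e / 4.
  by move/cvgrPdist_le: cV; apply.
exists y; near=> n.
have h1 : `|kfree_mean_square B n - sieve_mean_square y B n| <=
    c1 / n%:R + c2 / y%:R + c3 * `|rho - ef y.+1|.
  by apply: hc => //; near: n; [exists N | exists 1%N].
have h2 : c1 / n%:R < e / 4 by near: n; exact: inv_nat_lt.
have h3 : `|sieve_variance R (S y) B - sieve_mean_square y B n| <= e / 4.
  by near: n; exact: cV.
have -> : kfree_mean_square B n - sieve_variance R (S y) B =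
  (kfree_mean_square B n - sieve_mean_square y B n) -
  (sieve_variance R (S y) B - sieve_mean_square y B n) by ring.
apply: le_trans (ler_normB _ _) _; lra.
Unshelve. all: by end_near. Qed.

Lemma kfree_mean_square_ge0 B n : 0 <= kfree_mean_square B n.
Proof. by rewrite mulr_ge0 ?invr_ge0 ?sumr_ge0 // => m _; apply: sqr_ge0. Qed.

Lemma kfree_mean_square_cvg (B : {fset OK}) N : {subset B <= ball N} ->
  cvgn (kfree_mean_square B).
Proof.
move=> BN; apply/cauchy_cvgP; apply: cauchy_exP => e e0.
have e2 : 0 < e / 2 by lra.
have [y hy] := mean_square_approx BN e2.
exists (sieve_variance R (S y) B).
apply: filterS hy => n hn; rewrite /= -ball_normE /= distrC.
by apply: le_lt_trans hn _; lra.
Qed.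

Lemma kfree_mean_square_lim_le n :
  0 <= limn (kfree_mean_square (ball n)) <= #|` ball n|%:R * (d * (2 * n).+1 ^ d.-1)%:R.
Proof.
have sub : {subset ball n <= ball n} by [].
have cm := kfree_mean_square_cvg sub.
apply/andP; split.
  by apply: limr_ge cm _; apply: nearW => m; apply: kfree_mean_square_ge0.
apply/ler_addgt0Pr => e e0; apply: limr_le cm _.
have [y] := mean_square_approx sub e0; apply: filterS => m.
have := sieve_variance_le iota_bij R n (S_sieving y).
by move=> hV /(le_trans (ler_norm _)); lra.
Qed.

(** * Balls of real radius *)

Lemma int_normE a : int_norm R iota a = (nrm iota a)%:R.
Proof. by rewrite /int_norm /nrm natr_sum; apply: eq_bigr => i _; rewrite -abszE. Qed.

Lemma int_ball_ge0 (x : R) : 0 <= x ->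
  int_ball iota x = [set a | (nrm iota a <= Num.truncn x)%N].
Proof.
by move=> x0; apply/seteqP; split=> a /=; rewrite /int_ball /= int_normE truncn_ge_nat.
Qed.

Lemma int_ball_lt0 (x : R) : x < 0 -> int_ball iota x = set0.
Proof.
move=> x0; apply/seteqP; split=> a //=; rewrite /int_ball /= int_normE => h.
by have := lt_le_trans (le_lt_trans h x0) (ler0n R (nrm iota a)); rewrite ltxx.
Qed.

Lemma fset_int_ball (x : R) : 0 <= x -> fset_set (int_ball iota x) = ball (Num.truncn x).
Proof. by move=> /int_ball_ge0->. Qed.

Lemma int_ball_sub (x : R) : {subset fset_set (int_ball iota x) <= ball (Num.truncn x)}.
Proof.
have [/fset_int_ball->//|/int_ball_lt0->] := leP 0 x.
by rewrite fset_set0 => a; rewrite inE.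
Qed.

Lemma int_ball_finite (x : R) : finite_set (int_ball iota x).
Proof.
have [x0|/int_ball_lt0->//] := leP 0 x.
rewrite int_ball_ge0 //; have [+ _] := inj_card_fset_set (@cell1_inj _ _ _ iota_bij (Num.truncn x)).
by [].
Qed.

Lemma mean_squareE (N M : R) : 0 <= M ->
  mean_square iota k N M = kfree_mean_square (fset_set (int_ball iota N)) (Num.truncn M).
Proof.
move=> M0; rewrite /mean_square /kfree_mean_square /ball_card (fset_int_ball M0); congr (_ * _).
rewrite (fsbig_finite _ _ (int_ball_finite M)) (fset_int_ball M0).
apply: eq_bigr => m _; congr ((_ - _) ^+ 2).
have -> : [set n | int_ball iota N (n - m)] = (fun b => m + b) @` int_ball iota N.
  apply/seteqP; split=> [n /= h|_ [b /= h <-]]; last by rewrite /= addrC addKr.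
  by exists (n - m) => //; rewrite addrC subrK.
rewrite fsbig_image; last by move=> b c _ _ /addrI.
by rewrite fsbig_finite //; apply: int_ball_finite.
Qed.

Lemma cvg_truncn : Num.truncn M @[M --> (+oo : set_system R)] --> \oo.
Proof.
apply/cvgnyPge => n; near=> M.
have M0 : n%:R <= M by near: M; apply: nbhs_pinfty_ge; rewrite num_real.
by rewrite truncn_ge_nat // (le_trans _ M0).
Unshelve. all: by end_near. Qed.

Lemma mean_square_lim (N : R) :
  mean_square iota k N M @[M --> +oo] -->
  limn (kfree_mean_square (fset_set (int_ball iota N))).
Proof.
have cB := kfree_mean_square_cvg (@int_ball_sub N).
have cM := cvg_comp _ _ cvg_truncn cB.
apply: cvg_trans cM; apply: near_eq_cvg; near=> M.
rewrite mean_squareE //; near: M; apply: nbhs_pinfty_ge; exact: num_real.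
Unshelve. all: by end_near. Qed.

End KFreeVariance.

Theorem theorem2 (R : realType) (K : fieldExtType rat) (d k : nat)
    (iota : {additive 'rV[int]_d -> ringOfIntegers K})
    (iota_bij : bijective iota)
    (deg_K : \dim {:K} = d)
    (k_ge2 : (2 <= k)%N) :
  (forall N : R, cvg (mean_square iota k N M @[M --> +oo])) /\
  (exists2 C : R, 0 < C &
     \forall N \near +oo, `|kfree_variance iota k N| <= C * `|N ^+ (2 * d - 1)|).
Proof.
have lims := @mean_square_lim K d iota iota_bij R k k_ge2.
split=> [N|]; first by apply/cvg_ex; eexists; exact: lims.
have d0 := rank_gt0 iota_bij.
(* For N >= 1 and n = floor N, 2 n + 1 <= 3 N. *)
exists (d * 3 ^ (2 * d - 1))%:R; first by rewrite ltr0n muln_gt0 d0 expn_gt0.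
near=> N; have N1 : 1 <= N by near: N; apply: nbhs_pinfty_ge; exact: num_real.
have N0 : 0 <= N by apply: le_trans N1.
rewrite /kfree_variance (cvg_lim _ (lims N)) // fset_int_ball //.
set n := Num.truncn N.
have /andP[v0 v1] := kfree_mean_square_lim_le iota_bij R k_ge2 n.
rewrite ger0_norm // ger0_norm ?exprn_ge0 //; apply: le_trans v1 _.
have le3 : (2 * n).+1%:R <= 3 * N.
  have : n%:R <= N by rewrite -truncn_ge_nat.
  by rewrite -natr1 natrM; lra.
have -> : (2 * d - 1 = d + d.-1)%N by lia.
apply: (@le_trans _ _ ((2 * n).+1%:R ^+ d * (d%:R * (2 * n).+1%:R ^+ d.-1))).
  rewrite natrM natrX ler_wpM2r ?mulr_ge0 ?exprn_ge0 //.
  by rewrite -natrX ler_nat; apply: ball_card_le.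
rewrite mulrCA -exprD natrM natrX -mulrA ler_wpM2l // -exprMn.
by rewrite lerXn2r // nnegrE // mulr_ge0.
Unshelve. all: by end_near. Qed.
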